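(* Let $\nu\ge 2$ be an integer and $\phi(r)=r^{2\nu}\log r$ for $r>0$, $\phi(0)=0$. Let $\Omega\subset\mathbb{R}^2$ be a bounded connected open set whose boundary is an analytic curve, i.e. $\partial\Omega=\gamma([a,b])$ where $\gamma:[a,b]\to\mathbb{R}^2$ is analytic, $\gamma(a)=\gamma(b)$, and $\gamma$ is regular ($\gamma'(t)\neq(0,0)$ for every $t\in[a,b]$). Let $L=\int_a^b\|\gamma'(t)\|_2\,dt$. Let $\{P_i\}_{i\ge1}$ be a sequence of independent random points uniformly distributed in $\Omega$, and let $\{Q_h\}_{h\ge1}$ be a sequence of independent random points uniformly distributed on $\partial\Omega$, namely $Q_h=\gamma(t_h)$, where $\{t_h\}_{h\ge1}$ is a sequence of independent identically distributed random abscissas in $(a,b)$ with density $\|\gamma'(t)\|_2/L$; the two sequences $\{P_i\}$ and $\{t_h\}$ are independent of each other. For integers $n,m\ge0$ with $N=n+m$, let $K_N=K_N(\{P_i\}_{i=1}^n,\{Q_h\}_{h=1}^m)$ be the $N\times N$ Thin-Plate Spline Kansa collocation matrix for the Poisson equation with Dirichlet boundary conditions (defined in the context). Then for every $N\ge2$ (i.e. for all integers $n,m\ge 0$ with $n+m=N\geq 2$) the matrix $K_N$ is almost surely nonsingular.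
   Context: For $A\in\mathbb{R}^2$ put $\phi_A(P)=\phi(\|P-A\|_2)$, $P\in\mathbb{R}^2$. Its Laplacian in $P$ is the radial function $\Delta\phi_A(P)=4\nu r^{2(\nu-1)}(\nu\log r+1)$ with $r=\|P-A\|_2>0$, and $\Delta\phi_A(A)=0$ (the limit as $r\to0$, for $\nu\ge2$); also $\phi_A(A)=0$. Given points $P_1,\dots,P_n\in\Omega$ and $Q_1,\dots,Q_m\in\partial\Omega$, set $\phi_j=\phi_{P_j}$ ($1\le j\le n$) and $\psi_k=\phi_{Q_k}$ ($1\le k\le m$). The Kansa collocation matrix is the $(n+m)\times(n+m)$ block matrix $$K_N=\begin{pmatrix}\Delta\Phi&\Delta\Psi\\ \Phi&\Psi\end{pmatrix},$$ where $\Delta\Phi=(\Delta\phi_j(P_i))_{1\le i,j\le n}$, $\Delta\Psi=(\Delta\psi_k(P_i))_{1\le i\le n,\,1\le k\le m}$, $\Phi=(\phi_j(Q_h))_{1\le h\le m,\,1\le j\le n}$, $\Psi=(\psi_k(Q_h))_{1\le h,k\le m}$ (row index first). If $n=0$ or $m=0$ the corresponding blocks are empty. In particular all diagonal entries of $K_N$ are zero. *)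

(* Defs.v *)
From HB Require Import structures.
From mathcomp Require Import all_boot all_order all_algebra.
From mathcomp Require Import finmap.
From mathcomp Require Import all_classical all_reals all_analysis.

Set Implicit Arguments.
Unset Strict Implicit.
Unset Printing Implicit Defensive.

Import Order.TTheory GRing.Theory Num.Theory.
Import numFieldNormedType.Exports.

Local Open Scope classical_set_scope.
Local Open Scope ring_scope.

(** The library norm of [R * R] is the max norm: it has the right topology and
    bounded sets, but distances and lengths need the Euclidean norm. *)

Definition norm2 (R : realType) (v : R * R) : R :=
  Num.sqrt (v.1 ^+ 2 + v.2 ^+ 2).

Definition boundary (T : topologicalType) (A : set T) : set T :=
  closure A `\` interior A.

Definition leb2 (R : realType) : set (R * R) -> \bar R :=
  (@lebesgue_measure R \x @lebesgue_measure R)%E.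

Definition analytic_at (R : realType) (V : normedModType R)
    (f : R -> V) (t0 : R) : Prop :=
  exists c : nat -> V,
    \forall t \near t0, series (fun k => (t - t0) ^+ k *: c k) @ \oo --> f t.

(** [g] is a closed regular analytic curve on [[a, b]].  Analyticity on the
    closed interval means, as usual, analyticity near each of its points, so [g]
    also stands for an analytic extension slightly beyond the end points; in
    particular the two-sided derivatives at [a] and [b] are the one-sided ones.
    The values of [g] far from [[a, b]] are irrelevant.  Neither injectivity nor
    a smooth junction at [g a = g b] is required. *)
Definition closed_regular_analytic_curve (R : realType)
    (a b : R) (g : R -> R * R) : Prop :=
  [/\ a < b,
      forall t, t \in `[a, b] -> analytic_at g t,
      g a = g b &
      forall t, t \in `[a, b] -> derive1 g t != 0].

Definition curve_length (R : realType) (a b : R) (g : R -> R * R) : R :=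
  \int[@lebesgue_measure R]_(t in `[a, b]) norm2 (derive1 g t).

Section Independence.
Context d (T : measurableType d) (R : realType) (P : probability T R).

Definition sigma_rv d' (T' : measurableType d') (X : T -> T') :
  set (set T) := preimage_set_system setT X measurable.

(** Mutual (not just pairwise) independence. *)
Definition independent_rvs (I : choiceType) d' (T' : measurableType d')
    (X : I -> T -> T') : Prop :=
  forall (J : {fset I}) (E : I -> set T),
    (forall i, i \in J -> sigma_rv (X i) (E i)) ->
    P (\bigcap_(i in [set` J]) E i) = (\prod_(i <- J) P (E i))%E.

Definition sigma_family (I : Type) d' (T' : measurableType d')
    (X : I -> T -> T') : set (set T) :=
  <<s \bigcup_i sigma_rv (X i) >>.

Definition independent_families (I J : Type) d1 (T1 : measurableType d1)
    d2 (T2 : measurableType d2) (X : I -> T -> T1) (Y : J -> T -> T2) : Prop :=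
  forall A B, sigma_family X A -> sigma_family Y B ->
    P (A `&` B) = (P A * P B)%E.

(** Only the law is prescribed, so [X] lies in [Omega] almost surely.
    Meant for [Omega] of finite positive area. *)
Definition uniform_on (Omega : set (R * R)) (X : {RV P >-> (R * R)%type}) :=
  forall A : set (R * R), measurable A ->
    distribution P X A
    = ((fine (leb2 Omega))^-1%:E * leb2 (A `&` Omega))%E.

(** The density is [f] on [D] and [0] outside [D]. *)
Definition has_density (D : set R) (f : R -> R) (X : {RV P >-> R}) :=
  forall A : set R, measurable A ->
    distribution P X A
    = (\int[@lebesgue_measure R]_(t in A `&` D) (f t)%:E)%E.

End Independence.

Section Kansa.
Context (R : realType) (nu : nat).

(** At [r = 0] this is [0], because [0 ^+ nu.*2 = 0] for [0 < nu]. *)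
Definition tps (r : R) : R := r ^+ nu.*2 * ln r.

Definition tps_at (A Q : R * R) : R := tps (norm2 (Q - A)).

(** Sum of the two iterated directional derivatives.  The diagonal entries
    [laplacian (tps_at A) A] are [0] for [2 <= nu], as [tps_at A] is then of
    class C^2. *)
Definition laplacian (f : R * R -> R) (Q : R * R) : R :=
  'D_(1, 0) ('D_(1, 0) f) Q + 'D_(0, 1) ('D_(0, 1) f) Q.

Definition kansa_mx (n m : nat) (p : 'I_n -> R * R) (q : 'I_m -> R * R) :
    'M[R]_(n + m) :=
  block_mx
    (\matrix_(i < n, j < n) laplacian (tps_at (p j)) (p i))
    (\matrix_(i < n, k < m) laplacian (tps_at (q k)) (p i))
    (\matrix_(h < m, j < n) tps_at (p j) (q h))
    (\matrix_(h < m, k < m) tps_at (q k) (q h)).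

End Kansa.

(* Main.v *)
Require Import Defs.
From mathcomp Require Import all_boot all_order all_algebra perm.
From mathcomp Require Import finmap ring lra zify.
From mathcomp Require Import all_classical all_reals all_analysis.
From mathcomp Require Import measurable_realfun.

(** Both kernels have the form [z ^ k (al ln z + be)] in the squared distance [z],
    so along a regular analytic curve reaching a node at parameter [t] they become
    [x ^ (2 k) (a + b ln |x|)], where [x] is the local parameter, [a] and [b] are
    analytic and [b] does not vanish at [t].  Bordering a nonsingular matrix [K] by
    a point [z] gives [det = - det K (u K^-1 v)].  If [z] tends to a node [i] of the
    same type, then [u] and [v] tend to the [i]-th row and column of [K], so the part
    of [u K^-1 v] linear in the logarithm has leading coefficient
    [b ((K^-1 K) i i + (K K^-1) i i) = 2 b], as [K i i = 0].  Hence the bordered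
    determinant does not vanish on a punctured neighbourhood of [t].  By analytic
    continuation its zeros are countably many on the curve and, by Fubini applied to
    horizontal and vertical lines, a null set in the plane.  Starting from two points,
    one adds the others one at a time, each being independent of the previous ones. *)

Set Implicit Arguments.
Unset Strict Implicit.
Unset Printing Implicit Defensive.

Import Order.TTheory GRing.Theory Num.Theory.
Import numFieldNormedType.Exports.

Local Open Scope classical_set_scope.
Local Open Scope ring_scope.

(** * Analytic functions of one real variable *)

Section Analytic.
Context {R : realType}.
Implicit Types (f g : R -> R) (t : R) (c d : nat -> R).

(** The squared logarithm cannot cancel the linear one: it comes with [x ^ (4 k)] against
    [x ^ (2 k)], and [0 < k]. Nor can the analytic part: if its order is at least [2 k] the
    logarithm beats it, otherwise it beats every term carrying a logarithm. The type of the
    approached node matters because a row of the matrix uses the kernel of its own type: at a node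
    of the other type [u] does not tend to a row of [K], and the identity that produces [2 b] is
    lost. Types are arranged so that this case never arises. A boundary node is added along a curve
    that meets only boundary nodes among the earlier ones, since interior nodes lie in the open set
    [Omega]; at least one such node is required, to exclude identical vanishing. An interior node
    requires one earlier interior node, through which a vertical line is drawn. If both types occur,
    both are present from the start: for two nodes the determinant is, up to sign, a product of two
    entries, so a mixed pair is harmless. In the plane only horizontal and vertical lines are used,
    so functions of one variable suffice. *)

Definition taylor c (n : nat) (x : R) : R := \sum_(i < n) c i * x ^+ i.

(** Analyticity is expressed by geometric bounds on all Taylor remainders, which are
    stable under products and quotients without any manipulation of series. *)
Definition jet f t c := exists C M r : R,
  [/\ 0 < C, 0 < M, 0 < r,
      forall n x, `|x| < r -> `|f (t + x) - taylor c n x| <= C * (M * `|x|) ^+ n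
    & forall n, `|c n| <= C * M ^+ n].

Definition analytic f t := exists c, jet f t c.

Lemma taylorS c n x : taylor c n.+1 x = taylor c n x + c n * x ^+ n.
Proof. by rewrite /taylor big_ord_recr. Qed.

Lemma taylor0 c x : taylor c 0 x = 0.
Proof. by rewrite /taylor big_ord0. Qed.

Lemma jet_val f t c : jet f t c -> f t = c 0%N.
Proof.
move=> [C [M [r [C0 M0 r0 H _]]]].
have := H 1%N 0; rewrite normr0 mulr0 expr1 mulr0 => /(_ r0).
by rewrite taylorS taylor0 expr0 mulr1 add0r addr0 normr_le0 subr_eq0 => /eqP.
Qed.

(** The coefficient bounds come for free: [c n * x ^+ n] is the difference of two consecutive
    remainders at one fixed [x] with [M * x <= 1], which costs a factor 2 in the constant. *)
Lemma jet_remainder f t c (C M r : R) : 0 < C -> 0 < M -> 0 < r ->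
  (forall n x, `|x| < r -> `|f (t + x) - taylor c n x| <= C * (M * `|x|) ^+ n) ->
  jet f t c.
Proof.
move=> C0 M0 r0 H; exists (C + C), M, r; split => //.
- exact: addr_gt0.
- move=> n x xr; apply: le_trans (H n x xr) _.
  by apply: ler_wpM2r; [apply: exprn_ge0; rewrite mulr_ge0 // ltW | lra].
move=> n.
pose x := Num.min (r / 2) M^-1.
have x0 : 0 < x by rewrite lt_min invr_gt0 M0 divr_gt0.
have xr : `|x| < r.
  by rewrite gtr0_norm // gt_min; apply/orP; left; lra.
have Mx : M * x <= 1.
  have : x <= M^-1 by rewrite ge_min lexx orbT.
  by rewrite -(ler_pM2l M0) mulfV ?gt_eqF.
have := H n x xr; have := H n.+1 x xr; rewrite taylorS (gtr0_norm x0) => h1 h0.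
have h2 : `|c n * x ^+ n| <= C * (M * x) ^+ n.+1 + C * (M * x) ^+ n.
  have -> : c n * x ^+ n = (f (t + x) - taylor c n x) -
     (f (t + x) - (taylor c n x + c n * x ^+ n)) by ring.
  by rewrite [leRHS]addrC; apply: le_trans (ler_normB _ _) _; apply: lerD.
rewrite -(ler_pM2r (exprn_gt0 n x0)).
have -> : `|c n| * x ^+ n = `|c n * x ^+ n|.
  by rewrite normrM (ger0_norm (exprn_ge0 _ (ltW x0))).
apply: le_trans h2 _; rewrite -mulrA -exprMn mulrDl lerD2r ler_pM2l //.
rewrite exprS; apply: ler_piMl => //.
by rewrite exprn_ge0 // mulr_ge0 // ltW.
Qed.

Lemma jet_common_bound f g t c d : jet f t c -> jet g t d -> exists C M r : R,
  [/\ 0 < C, 0 < M, 0 < r,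
   (forall n x, `|x| < r ->
      `|f (t + x) - taylor c n x| <= C * (M * `|x|) ^+ n /\
      `|g (t + x) - taylor d n x| <= C * (M * `|x|) ^+ n)
   & forall n, `|c n| <= C * M ^+ n /\ `|d n| <= C * M ^+ n].
Proof.
move=> [C1 [M1 [r1 [C10 M10 r10 H1 K1]]]] [C2 [M2 [r2 [C20 M20 r20 H2 K2]]]].
exists (Num.max C1 C2), (Num.max M1 M2), (Num.min r1 r2).
have mx a b (n : nat) : 0 < a -> 0 < b ->
  forall y, 0 <= y -> C1 * (a * y) ^+ n <= Num.max C1 C2 * (Num.max a b * y) ^+ n.
  move=> a0 b0 y y0; apply: ler_pM; rewrite ?exprn_ge0 ?mulr_ge0 ?(ltW C10) ?(ltW a0) //.
    by rewrite le_max lexx.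
  apply: lerXn2r; rewrite ?nnegrE ?mulr_ge0 ?(ltW a0) //.
    by rewrite le_max (ltW a0).
  by apply: ler_wpM2r => //; rewrite le_max lexx.
have mx' a b (n : nat) : 0 < a -> 0 < b ->
  forall y, 0 <= y -> C2 * (b * y) ^+ n <= Num.max C1 C2 * (Num.max a b * y) ^+ n.
  move=> a0 b0 y y0; apply: ler_pM; rewrite ?exprn_ge0 ?mulr_ge0 ?(ltW C20) ?(ltW b0) //.
    by rewrite le_max lexx orbT.
  apply: lerXn2r; rewrite ?nnegrE ?mulr_ge0 ?(ltW b0) //.
    by rewrite le_max (ltW a0).
  by apply: ler_wpM2r => //; rewrite le_max lexx orbT.
split; rewrite ?lt_max ?lt_min ?C10 ?M10 ?r10 //.
- move=> n x; rewrite lt_min => /andP[xr1 xr2]; split.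
    by apply: le_trans (H1 n x xr1) _; apply: mx.
  by apply: le_trans (H2 n x xr2) _; apply: mx'.
- move=> n; split.
    by apply: le_trans (K1 n) _; have := mx M1 M2 n M10 M20 1 ler01; rewrite !mulr1.
  by apply: le_trans (K2 n) _; have := mx' M1 M2 n M10 M20 1 ler01; rewrite !mulr1.
Qed.

Lemma jet_near f g t c (e : R) : 0 < e -> (forall x, `|x| < e -> f (t + x) = g (t + x)) ->
  jet f t c -> jet g t c.
Proof.
move=> e0 fg [C [M [r [C0 M0 r0 H K]]]]; exists C, M, (Num.min r e).
split; rewrite ?lt_min ?r0 ?e0 //.
by move=> n x; rewrite lt_min => /andP[xr xe]; rewrite -fg //; exact: H.
Qed.

Lemma jetD f g t c d : jet f t c -> jet g t d ->
  jet (fun s => f s + g s) t (fun i => c i + d i).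
Proof.
move=> jf jg; have [C [M [r [C0 M0 r0 H K]]]] := jet_common_bound jf jg.
apply: (@jet_remainder _ _ _ (C + C) M r); rewrite ?addr_gt0 // => n x xr.
have [h1 h2] := H n x xr.
have -> : taylor (fun i => c i + d i) n x = taylor c n x + taylor d n x.
  by rewrite /taylor -big_split; apply: eq_bigr => i _; rewrite mulrDl.
rewrite opprD addrACA mulrDl; apply: le_trans (ler_normD _ _) _.
exact: lerD.
Qed.

Lemma jetZ f t c (a : R) : jet f t c -> jet (fun s => a * f s) t (fun i => a * c i).
Proof.
move=> [C [M [r [C0 M0 r0 H K]]]].
have a1 : 0 < `|a| + 1 by rewrite ltr_wpDl.
apply: (@jet_remainder _ _ _ ((`|a| + 1) * C) M r) => //; first exact: mulr_gt0.
move=> n x xr.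
have -> : taylor (fun i => a * c i) n x = a * taylor c n x.
  by rewrite /taylor mulr_sumr; apply: eq_bigr => i _; rewrite mulrA.
rewrite -mulrBr normrM -mulrA; apply: ler_pM => //; last exact: H.
by rewrite lerDl.
Qed.

Lemma jet_cst (a : R) t : jet (fun=> a) t (fun i => if i == 0%N then a else 0).
Proof.
have a1 : 0 < `|a| + 1 by rewrite ltr_wpDl.
apply: (@jet_remainder _ _ _ (`|a| + 1) 1 1) => // n x _.
case: n => [|n].
  by rewrite taylor0 subr0 expr0 mulr1 lerDl.
have -> : taylor (fun i => if i == 0%N then a else 0) n.+1 x = a.
  rewrite /taylor big_ord_recl /= expr0 mulr1 big1 ?addr0 // => i _.
  by rewrite /bump /= add1n mul0r.
by rewrite subrr normr0 mulr_ge0 ?exprn_ge0 ?mulr_ge0 // ltW.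
Qed.

Lemma jet_var t : jet (fun s => s - t) t (fun i => if i == 1%N then 1 else 0).
Proof.
apply: (@jet_remainder _ _ _ 1 1 1); rewrite ?ltr01 // => n x x1.
rewrite !mul1r (addrC t) addrK.
case: n => [|[|n]].
- by rewrite taylor0 subr0 expr0 ltW.
- by rewrite taylorS taylor0 mul0r addr0 subr0 expr1.
have -> : taylor (fun i => if i == 1%N then 1 else 0) n.+2 x = x.
  rewrite /taylor 2!big_ord_recl /= mul0r add0r /bump /= mul1r expr1.
  by rewrite big1 ?addr0 // => i _; rewrite /bump /= !add1n mul0r.
by rewrite subrr normr0 exprn_ge0.
Qed.

Definition cauchy_product c d (n : nat) := \sum_(j < n.+1) c j * d (n - j)%N.

(** Groups the terms of total degree below [n] by the degree that comes from [c]. *)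
Lemma taylor_cauchy c d n x :
  taylor (cauchy_product c d) n x = \sum_(j < n) c j * x ^+ j * taylor d (n - j) x.
Proof.
elim: n => [|n IH]; first by rewrite taylor0 big_ord0.
rewrite taylorS IH big_ord_recr /=.
rewrite [in RHS](_ : \sum_(i < n) _ = \sum_(i < n) c i * x ^+ i * taylor d (n - i) x +
  \sum_(i < n) c i * d (n - i)%N * x ^+ n); last first.
  rewrite -big_split; apply: eq_bigr => i _ /=.
  rewrite subSn; last exact: ltnW.
  rewrite taylorS mulrDr; congr (_ + _).
  have -> : x ^+ n = x ^+ i * x ^+ (n - i) by rewrite -exprD subnKC // ltnW.
  ring.
rewrite subSnn taylorS taylor0 add0r expr0 mulr1 -addrA; congr (_ + _).
by rewrite /cauchy_product big_ord_recr /= subnn mulrDl mulr_suml; congr (_ + _); ring.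
Qed.


(** Absorbs the number of terms of a convolution, or the factor of a differentiated series, into the
    geometric rate, which doubles. *)
Lemma leq_nat_exp2 (n : nat) : n.+1%:R <= 2 ^+ n :> R.
Proof. by rewrite -natrX ler_nat; elim: n => // n IH; rewrite expnS mul2n -addnn; lia. Qed.
End Analytic.

(** * Sums, products, determinants and reciprocals of analytic functions *)

Section AnalyticAlgebra.
Context {R : realType}.
Implicit Types (f g : R -> R) (t : R) (c d : nat -> R).

Lemma jetM f g t c d : jet f t c -> jet g t d ->
  jet (fun s => f s * g s) t (cauchy_product c d).
Proof.
move=> jf jg; have [C [M [r [C0 M0 r0 H K]]]] := jet_common_bound jf jg.
apply: (@jet_remainder _ _ _ _ (C * C) (2 * M) r); rewrite ?mulr_gt0 // => n x xr.
have Mx0 : 0 <= M * `|x| by rewrite mulr_ge0 // ltW.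
(* In the [j]-th summand the remainder of [g] supplies the missing [n - j] powers of [x], so every
   error term has order [n]. *)
have -> : f (t + x) * g (t + x) - taylor (cauchy_product c d) n x =
    \sum_(j < n) c j * x ^+ j * (g (t + x) - taylor d (n - j) x) +
    (f (t + x) - taylor c n x) * g (t + x).
  rewrite taylor_cauchy.
  under [in RHS]eq_bigr do rewrite mulrBr.
  rewrite sumrB /= -mulr_suml -/(taylor c n x); ring.
apply: le_trans (ler_normD _ _) _.
have g_le : `|g (t + x)| <= C.
  by have [_] := H 0%N x xr; rewrite taylor0 subr0 expr0 mulr1.
have h1 : `|(f (t + x) - taylor c n x) * g (t + x)| <= C * C * (M * `|x|) ^+ n.
  rewrite normrM mulrAC; apply: ler_pM => //.
  by have [] := H n x xr.
have h2 : `|\sum_(j < n) c j * x ^+ j * (g (t + x) - taylor d (n - j) x)| <=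
    n%:R * (C * C * (M * `|x|) ^+ n).
  apply: le_trans (ler_norm_sum _ _ _) _.
  rewrite -[n in n%:R]card_ord mulr_natl -sumr_const; apply: ler_sum => j _.
  have [k1 _] := K j; have [_ k2] := H (n - j)%N x xr.
  rewrite !normrM normrX.
  have -> : C * C * (M * `|x|) ^+ n =
     C * M ^+ j * `|x| ^+ j * (C * (M * `|x|) ^+ (n - j)).
    have -> : (M * `|x|) ^+ n = (M * `|x|) ^+ j * (M * `|x|) ^+ (n - j).
      by rewrite -exprD subnKC // ltnW.
    rewrite exprMn; ring.
  apply: ler_pM => //.
  by apply: ler_wpM2r => //; rewrite exprn_ge0.
apply: le_trans (lerD h2 h1) _.
rewrite -[X in _ + X]mul1r -mulrDl -natr1 /=.
rewrite -[2 * M * _]mulrA [in leRHS]exprMn [leRHS]mulrCA.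
apply: ler_wpM2r; first by rewrite !mulr_ge0 ?exprn_ge0 // ltW.
by rewrite natr1 leq_nat_exp2.
Qed.

Lemma analytic_cst (a : R) t : analytic (fun=> a) t.
Proof. by eexists; exact: jet_cst. Qed.

Lemma analyticD f g t : analytic f t -> analytic g t -> analytic (fun s => f s + g s) t.
Proof. by move=> [c jc] [d jd]; eexists; exact: jetD jc jd. Qed.

Lemma analyticM f g t : analytic f t -> analytic g t -> analytic (fun s => f s * g s) t.
Proof. by move=> [c jc] [d jd]; eexists; exact: jetM jc jd. Qed.

Lemma analyticZ f t (a : R) : analytic f t -> analytic (fun s => a * f s) t.
Proof. by move=> [c jc]; eexists; exact: jetZ jc. Qed.

Lemma analyticX f t n : analytic f t -> analytic (fun s => f s ^+ n) t.
Proof.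
move=> af; elim: n => [|n IH]; first exact: analytic_cst.
by under eq_fun do rewrite exprS; exact: analyticM.
Qed.

Lemma analytic_sum (I : Type) (s : seq I) (P : pred I) (F : I -> R -> R) t :
  (forall i, P i -> analytic (F i) t) -> analytic (fun s0 => \sum_(i <- s | P i) F i s0) t.
Proof.
move=> aF; elim: s => [|i s IH].
  by under eq_fun do rewrite big_nil; exact: analytic_cst.
under eq_fun do rewrite big_cons.
case: (boolP (P i)) => // Pi; by apply: analyticD => //; exact: aF.
Qed.

Lemma analytic_prod (I : Type) (s : seq I) (P : pred I) (F : I -> R -> R) t :
  (forall i, P i -> analytic (F i) t) -> analytic (fun s0 => \prod_(i <- s | P i) F i s0) t.
Proof.
move=> aF; elim: s => [|i s IH].
  by under eq_fun do rewrite big_nil; exact: analytic_cst.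
under eq_fun do rewrite big_cons.
case: (boolP (P i)) => // Pi; by apply: analyticM => //; exact: aF.
Qed.

Lemma analytic_det n (A : R -> 'M[R]_n) t : (forall i j, analytic (fun s => A s i j) t) ->
  analytic (fun s => \det (A s)) t.
Proof.
move=> aA; rewrite /determinant.
by apply: analytic_sum => s _; apply: analyticZ; apply: analytic_prod => i _; exact: aA.
Qed.

Lemma analytic_near f g t (e : R) : 0 < e -> (forall x, `|x| < e -> f (t + x) = g (t + x)) ->
  analytic f t -> analytic g t.
Proof. by move=> e0 fg [c jc]; exists c; exact: jet_near e0 fg jc. Qed.

Lemma taylor_bound c (C M : R) n (x : R) : 0 < C -> 0 < M ->
  (forall k, `|c k| <= C * M ^+ k) -> M * `|x| <= 1 / 2 -> `|taylor c n x| <= C * 2.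
Proof.
move=> C0 M0 H Mx.
have Mx0 : 0 <= M * `|x| by rewrite mulr_ge0 // ltW.
suff : `|taylor c n x| <= C * (2 - 2 * (1 / 2) ^+ n).
  move/le_trans; apply; rewrite ler_pM2l //.
  have : 0 <= (1 / 2 : R) ^+ n by rewrite exprn_ge0 //; lra.
  by move=> ?; lra.
elim: n => [|n IH]; first by rewrite taylor0 normr0 expr0 mulr1 subrr mulr0.
rewrite taylorS; apply: le_trans (ler_normD _ _) _.
have h : `|c n * x ^+ n| <= C * (1 / 2) ^+ n.
  rewrite normrM normrX; apply: (@le_trans _ _ (C * M ^+ n * `|x| ^+ n)).
    by apply: ler_wpM2r => //; rewrite exprn_ge0.
  rewrite -mulrA -exprMn ler_pM2l //; apply: lerXn2r => //; rewrite nnegrE; lra.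
apply: le_trans (lerD IH h) _.
by rewrite -mulrDr ler_pM2l // exprS; lra.
Qed.


(** The first [n] coefficients of the reciprocal power series. Each one depends on all the previous
    ones, hence the list; the boolean term is the right-hand side of the convolution equation, 1 in
    degree 0 and 0 above. *)
Fixpoint inv_seq c (n : nat) : seq R :=
  if n is m.+1 then
    rcons (inv_seq c m) (- (c 0%N)^-1 *
      ((\sum_(j < m) (inv_seq c m)`_j * c (m - j)%N) - (m == 0%N)%:R))
  else [::].

Lemma inverse_series c : c 0%N != 0 ->
  exists d, forall n, cauchy_product d c n = (n == 0%N)%:R.
Proof.
move=> c0; pose d n := (inv_seq c n.+1)`_n.
have sz n : size (inv_seq c n) = n by elim: n => //= n IH; rewrite size_rcons IH.
have nd n i : (i < n)%N -> (inv_seq c n)`_i = d i.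
  elim: n => // n IH; rewrite ltnS leq_eqVlt => /orP[/eqP -> //|i_n].
  by rewrite /= nth_rcons sz i_n IH.
exists d => n; rewrite /cauchy_product big_ord_recr /= subnn.
have -> : d n = - (c 0%N)^-1 * ((\sum_(j < n) d j * c (n - j)%N) - (n == 0%N)%:R).
  rewrite {1}/d /= nth_rcons sz ltnn eqxx; congr (_ * (_ - _)).
  by apply: eq_bigr => i _; rewrite nd.
by field.
Qed.

(** With [K = C / |c 0|], the rate [N = M (1 + K)] satisfies [N - M = M K], so that [K] times the
    sum of [N ^ j M ^ (n - j)] over [j < n] telescopes to [N ^ n - M ^ n]. Strong induction on the
    recursion then closes. *)
Lemma inverse_series_bound c d (C M : R) : 0 < C -> 0 < M -> c 0%N != 0 ->
  (forall n, `|c n| <= C * M ^+ n) ->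
  (forall n, cauchy_product d c n = (n == 0%N)%:R) ->
  forall n, `|d n| <= `|c 0%N|^-1 * (M * (1 + C / `|c 0%N|)) ^+ n.
Proof.
move=> C0 M0 c0 H dc; pose K := C / `|c 0%N|; pose N := M * (1 + K).
have nc0 : 0 < `|c 0%N| by rewrite normr_gt0.
have K0 : 0 < K by rewrite divr_gt0.
have N0 : 0 < N by rewrite mulr_gt0 // addr_gt0.
have geo n : K * \sum_(j < n) N ^+ j * M ^+ (n - j) <= N ^+ n.
  elim: n => [|n IH]; first by rewrite big_ord0 mulr0 expr0 ler01.
  rewrite big_ord_recr /= subSnn expr1.
  have -> : \sum_(i < n) N ^+ i * M ^+ (n.+1 - i) = M * \sum_(i < n) N ^+ i * M ^+ (n - i).
    rewrite mulr_sumr; apply: eq_bigr => i _.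
    by rewrite subSn ?exprS; [ring|exact: ltnW].
  have -> : K * (M * (\sum_(i < n) N ^+ i * M ^+ (n - i)) + N ^+ n * M) =
    M * (K * (\sum_(i < n) N ^+ i * M ^+ (n - i)) + K * N ^+ n) by ring.
  apply: (@le_trans _ _ (M * (N ^+ n + K * N ^+ n))).
    by rewrite ler_pM2l // lerD2r.
  by rewrite exprS {2}/N (_ : M * (N ^+ n + K * N ^+ n) = M * (1 + K) * N ^+ n) //; ring.
move=> n; rewrite -/K -/N; elim/ltn_ind: n => -[|n] IH.
  have := dc 0%N; rewrite /cauchy_product big_ord_recl big_ord0 addr0 /= subn0 expr0 mulr1.
  by move=> /(canRL (mulfK c0)) ->; rewrite mul1r normfV.
have := dc n.+1; rewrite /cauchy_product big_ord_recr /= subnn => /eqP.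
rewrite addrC addr_eq0 => /eqP /(canRL (mulfK c0)) ->.
rewrite normrM normfV normrN mulrC ler_pM2l ?invr_gt0 //.
apply: le_trans (ler_norm_sum _ _ _) _; apply: le_trans _ (geo n.+1).
rewrite mulr_sumr; apply: ler_sum => j _; rewrite normrM.
have -> : K * (N ^+ j * M ^+ (n.+1 - j)) =
  (`|c 0%N|^-1 * N ^+ j) * (C * M ^+ (n.+1 - j)) by rewrite /K; ring.
by apply: ler_pM => //; exact: IH.
Qed.

Lemma analytic_inv f t : analytic f t -> f t != 0 -> analytic (fun s => (f s)^-1) t.
Proof.
move=> [c jf]; rewrite (jet_val jf) => c0.
have [d dc] := inverse_series c0.
have [C [M [r [C0 M0 r0 H K]]]] := jf.
have nc0 : 0 < `|c 0%N| by rewrite normr_gt0.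
have bd := inverse_series_bound C0 M0 c0 K dc.
set N := M * _ in bd.
have N0 : 0 < N by rewrite mulr_gt0 // addr_gt0 // divr_gt0.
have K1 : 1 <= 1 + C / `|c 0%N| by rewrite lerDl ltW // divr_gt0.
have MN : M <= N by rewrite ler_peMr // ltW.
(* Within this radius the first remainder [C * M * |x|] is at most [|c 0| / 2], which keeps [f] away
   from 0. *)
pose r' := Num.min r (`|c 0%N| / 2 / (C * M)).
have r'0 : 0 < r' by rewrite lt_min r0 divr_gt0 ?mulr_gt0 // divr_gt0.
exists d.
pose E := 2 / `|c 0%N| * (1 + C / `|c 0%N|).
have E0 : 0 < E by apply: mulr_gt0; [exact: divr_gt0 | exact: lt_le_trans K1].
apply: (@jet_remainder _ _ _ _ E (2 * N) r') => //; first exact: mulr_gt0.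
move=> n x.
rewrite lt_min => /andP[xr xr2].
have fx : `|c 0%N| / 2 <= `|f (t + x)|.
  have := H 1%N x xr; rewrite taylorS taylor0 add0r expr0 mulr1 expr1 => h.
  have h2 : C * (M * `|x|) <= `|c 0%N| / 2.
    by rewrite mulrA mulrC -ler_pdivlMr ?mulr_gt0 // ltW.
  have := ler_normB (f (t + x)) (f (t + x) - c 0%N).
  rewrite opprB addrC subrK => h3; lra.
have fx0 : f (t + x) != 0 by rewrite -normr_gt0; apply: lt_le_trans fx; rewrite divr_gt0.
have ifx : `|(f (t + x))^-1| <= 2 / `|c 0%N|.
  rewrite normfV -[X in _ <= X]invrK lef_pV2 ?posrE ?normr_gt0 //.
    by rewrite invfM invrK mulrC.
  by rewrite invr_gt0 divr_gt0.
have nx0 := normr_ge0 x.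
case: n => [|n].
  rewrite taylor0 subr0 expr0 mulr1; apply: le_trans ifx _.
  by rewrite ler_peMr // divr_ge0.
(* The Taylor polynomial of the convolution of [d] and [c] is 1, so [1 - f * taylor d] is a
   combination of remainders of [f]. *)
have -> : (f (t + x))^-1 - taylor d n.+1 x = (f (t + x))^-1 *
    \sum_(j < n.+1) d j * x ^+ j * (taylor c (n.+1 - j) x - f (t + x)).
  under eq_bigr do rewrite mulrBr.
  rewrite sumrB -taylor_cauchy -mulr_suml -/(taylor d n.+1 x).
  have -> : taylor (cauchy_product d c) n.+1 x = 1.
    rewrite /taylor big_ord_recl dc expr0 mulr1 big1 ?addr0 // => i _.
    by rewrite dc /= mul0r.
  by field.
rewrite normrM.
have h2 : `|\sum_(j < n.+1) d j * x ^+ j * (taylor c (n.+1 - j) x - f (t + x))| <=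
    n.+1%:R * (C / `|c 0%N| * (N * `|x|) ^+ n.+1).
  apply: le_trans (ler_norm_sum _ _ _) _.
  rewrite -[X in X%:R * _](card_ord n.+1) mulr_natl -sumr_const; apply: ler_sum => j _.
  have k1 := bd j; have k2 := H (n.+1 - j)%N x xr.
  rewrite !normrM normrX distrC.
  have -> : C / `|c 0%N| * (N * `|x|) ^+ n.+1 =
     (`|c 0%N|^-1 * N ^+ j) * `|x| ^+ j * (C * (N * `|x|) ^+ (n.+1 - j)).
    have -> : (N * `|x|) ^+ n.+1 = (N * `|x|) ^+ j * (N * `|x|) ^+ (n.+1 - j).
      by rewrite -exprD subnKC // ltnW.
    rewrite exprMn; ring.
  apply: ler_pM => //.
    by apply: ler_wpM2r => //; rewrite exprn_ge0.
  apply: le_trans k2 _; rewrite ler_pM2l //; apply: lerXn2r.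
  - by rewrite nnegrE mulr_ge0 // ltW.
  - by rewrite nnegrE mulr_ge0 // ltW.
  - by apply: ler_wpM2r.
apply: le_trans (ler_pM _ _ ifx h2) _ => //.
rewrite /E -[leRHS]mulrA ler_pM2l ?divr_gt0 //.
rewrite -(mulrA 2) [in leRHS]exprMn [leRHS]mulrCA.
have q0 : 0 <= (N * `|x|) ^+ n.+1 by rewrite exprn_ge0 // mulr_ge0 // ltW.
apply: ler_pM.
- by rewrite ler0n.
- by rewrite mulr_ge0 // divr_ge0 // ltW.
- apply: le_trans (leq_nat_exp2 n) _; rewrite exprS ler_peMl ?exprn_ge0 //; lra.
- by apply: ler_wpM2r => //; lra.
Qed.
End AnalyticAlgebra.

(** * Derivatives, primitives, logarithms and isolated zeros of analytic functions *)

Section AnalyticCalculus.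
Context {R : realType}.
Implicit Types (f g : R -> R) (t : R) (c d : nat -> R).

Lemma pseriesE c x : pseries c x = fun n => taylor c n x.
Proof. by apply/funext => n; rewrite /pseries /series /= big_mkord. Qed.

Lemma is_cvg_pseries_bound c (C M : R) (x : R) : 0 < C -> 0 < M ->
  (forall n, `|c n| <= C * M ^+ n) -> M * `|x| < 1 -> cvgn (pseries c x).
Proof.
move=> C0 M0 H Mx; apply: normed_cvg.
have Mx0 : 0 <= M * `|x| by rewrite mulr_ge0 // ltW.
apply: (@series_le_cvg _ _ (geometric C (M * `|x|))) => //.
- by move=> n; exact: normr_ge0.
- by move=> n /=; rewrite /geometric /= mulr_ge0 ?exprn_ge0 // ltW.
- move=> n /=; rewrite normrM normrX exprMn mulrA.
  by apply: ler_wpM2r; rewrite ?exprn_ge0.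
- by apply: is_cvg_geometric_series; rewrite ger0_norm.
Qed.

Lemma taylor_tail c (C M : R) n m (x : R) : 0 < C -> 0 < M ->
  (forall k, `|c k| <= C * M ^+ k) -> M * `|x| <= 1 / 2 -> (n <= m)%N ->
  `|taylor c m x - taylor c n x| <= C * 2 * (M * `|x|) ^+ n.
Proof.
move=> C0 M0 H Mx /subnKC <-.
have -> : taylor c (n + (m - n)) x - taylor c n x =
    x ^+ n * taylor (fun k => c (n + k)%N) (m - n) x.
  rewrite /taylor big_split_ord /= [LHS]addrC. rewrite addKr mulr_sumr.
  by apply: eq_bigr => i _; rewrite exprD mulrCA.
rewrite normrM normrX exprMn.
have CM : 0 < C * M ^+ n by rewrite mulr_gt0 // exprn_gt0.
have H2 k : `|c (n + k)%N| <= C * M ^+ n * M ^+ k by rewrite -mulrA -exprD.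
have := taylor_bound (m - n) CM M0 H2 Mx => h.
apply: le_trans (ler_wpM2l _ h) _; first by rewrite exprn_ge0.
by rewrite le_eqVlt; apply/orP; left; apply/eqP; ring.
Qed.

Lemma jet_pseries c (C M : R) t : 0 < C -> 0 < M ->
  (forall n, `|c n| <= C * M ^+ n) ->
  jet (fun s => limn (pseries c (s - t))) t c.
Proof.
move=> C0 M0 H.
have r0 : 0 < 1 / 2 / M by rewrite !divr_gt0.
apply: (@jet_remainder _ _ _ _ (C * 2) M (1 / 2 / M)) => //; first exact: mulr_gt0.
move=> n x; rewrite (addrC t) addrK ltr_pdivlMr // mulrC => xr.
have cv : cvgn (pseries c x).
  by apply: is_cvg_pseries_bound C0 M0 H _; apply: lt_trans xr _; lra.
rewrite pseriesE in cv *.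
have cv2 : (fun m => `|taylor c m x - taylor c n x|) @ \oo -->
    `|limn (fun m => taylor c m x) - taylor c n x|.
  by apply: cvg_norm; apply: cvgB => //; exact: cvg_cst.
rewrite -(cvg_lim _ cv2) //; apply: limr_le; first exact: cvgP cv2.
near=> m; apply: taylor_tail => //; first exact: ltW.
by near: m; exists n.
Unshelve. all: by end_near. Qed.

Lemma pseries_diffs_bound c (C M : R) : 0 < C -> 0 < M ->
  (forall n, `|c n| <= C * M ^+ n) ->
  forall n, `|pseries_diffs c n| <= C * M * (2 * M) ^+ n.
Proof.
move=> C0 M0 H n; rewrite /pseries_diffs normrM ger0_norm ?ler0n //.
have -> : C * M * (2 * M) ^+ n = 2 ^+ n * (C * M ^+ n.+1).
  by rewrite exprMn exprS; ring.
by apply: ler_pM => //; exact: leq_nat_exp2.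
Qed.

Lemma jet_lim f t c : jet f t c ->
  exists2 e : R, 0 < e & forall x, `|x| < e -> f (t + x) = limn (pseries c x).
Proof.
move=> [C [M [r [C0 M0 r0 H K]]]].
exists (Num.min r M^-1); first by rewrite lt_min r0 invr_gt0.
move=> x; rewrite lt_min => /andP[xr xM].
have Mx : M * `|x| < 1 by rewrite mulrC -ltr_pdivlMr // mul1r.
have Mx0 : 0 <= M * `|x| by rewrite mulr_ge0 // ltW.
rewrite pseriesE; apply/esym/cvg_lim => //.
apply/cvgrPdist_le => e e0.
have : geometric C (M * `|x|) @ \oo --> (0 : R).
  by apply: cvg_geometric; rewrite ger0_norm.
move=> /cvgrPdist_le /(_ e e0); apply: filterS => n /=.
rewrite sub0r normrN => h; apply: le_trans (H n x xr) _.
by apply: le_trans h; exact: ler_norm.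
Qed.

Definition deriv_near f g t :=
  exists2 e : R, 0 < e & forall x : R, `|x| < e ->
    is_derive x (1 : R) (fun y => f (t + y)) (g (t + x)).

Lemma nbhs_normlt (x e : R) : `|x| < e -> \forall y \near x, `|y| < e.
Proof.
by move=> xe; have /(_ _ _ xe) := @cvgr_norm_lt _ _ _ _ _ id x cvg_id; apply.
Qed.

Lemma analytic_derive f t : analytic f t -> exists2 g, analytic g t & deriv_near f g t.
Proof.
move=> [c jf].
have [e e0 fE] := jet_lim jf.
have [C [M [r [C0 M0 r0 H K]]]] := jf.
have K1 := pseries_diffs_bound C0 M0 K.
have CM0 : 0 < C * M by rewrite mulr_gt0.
have M20 : 0 < 2 * M by rewrite mulr_gt0.
have K2 := pseries_diffs_bound CM0 M20 K1.
have CM20 : 0 < C * M * (2 * M) by rewrite mulr_gt0.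
have M40 : 0 < 2 * (2 * M) by rewrite mulr_gt0.
exists (fun s => limn (pseries (pseries_diffs c) (s - t))).
  exists (pseries_diffs c); exact: jet_pseries CM0 M20 K1.
(* Term-by-term differentiation asks for convergence at [k] of the series and of its first two
   formal derivatives, whose rates are [M], [2 M] and [4 M]. *)
pose k := (8 * M)^-1.
have k0 : 0 < k by rewrite invr_gt0 mulr_gt0.
have Mk : M * k = 8^-1 by rewrite /k invfM mulrCA mulfV ?gt_eqF // mulr1.
exists (Num.min e k); first by rewrite lt_min e0.
move=> x xek; rewrite (addrC t) addrK.
have /andP[xe xk] : (`|x| < e) && (`|x| < k) by rewrite -lt_min.
have [k1 k2 k3] : [/\ M * `|k| < 1, (2 * M) * `|k| < 1 & 2 * (2 * M) * `|k| < 1].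
  by rewrite gtr0_norm // -!mulrA Mk; split; lra.
have := @pseries_snd_diffs _ c k x (is_cvg_pseries_bound C0 M0 K k1)
  (is_cvg_pseries_bound CM0 M20 K1 k2) (is_cvg_pseries_bound CM20 M40 K2 k3).
rewrite (gtr0_norm k0) => /(_ xk); apply: near_eq_is_derive.
near=> y; rewrite fE //; near: y; exact: nbhs_normlt.
Unshelve. all: by end_near. Qed.

Lemma mvt_ball (G G' : R -> R) (r x : R) :
  (forall y : R, `|y| < r -> is_derive y (1 : R) G (G' y)) -> `|x| < r ->
  exists2 y, `|y| <= `|x| & G x - G 0 = G' y * x.
Proof.
move=> dG xr.
have ct a b : (forall y, y \in `[a, b] -> `|y| < r) -> {within `[a, b], continuous G}.
  move=> ab; apply: derivable_within_continuous => y /ab /dG ?.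
  exact: ex_derive.
have [x0|x0] := leP 0 x.
  have io y : y \in `[0, x] -> `|y| <= `|x|.
    by rewrite in_itv /= => /andP[y0 yx]; rewrite !ger0_norm.
  have [||y /io yx ->] := @MVT_segment _ G G' 0 x x0; last first.
  - by exists y => //; rewrite subr0.
  - by apply: ct => y /io; move/le_lt_trans; apply.
  - move=> y yi; apply: dG; apply: le_lt_trans xr; apply: io.
    exact: subset_itv_oo_cc yi.
have io y : y \in `[x, 0] -> `|y| <= `|x|.
  by rewrite in_itv /= => /andP[y0 yx]; rewrite !ler0_norm ?lerN2 // ltW.
have [||y /io yx e] := @MVT_segment _ G G' x 0 (ltW x0); last first.
- by exists y => //; rewrite -opprB e sub0r mulrN opprK.
- by apply: ct => y /io; move/le_lt_trans; apply.
- move=> y yi; apply: dG; apply: le_lt_trans xr; apply: io.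
  exact: subset_itv_oo_cc yi.
Qed.

Lemma is_derive_taylor c d n x : (forall k, d k.+1 *+ k.+1 = c k) ->
  is_derive x (1 : R) (taylor d n.+1) (taylor c n x).
Proof.
move=> dc; elim: n => [|n IH].
  rewrite taylor0 (_ : taylor d 1 = cst (d 0%N)); first exact: is_derive_cst.
  by apply/funext => y; rewrite taylorS taylor0 add0r expr0 mulr1.
rewrite (_ : taylor d n.+2 = taylor d n.+1 + (d n.+1 *: (id ^+ n.+1)) :> (R -> R)); last first.
  by apply/funext => y; rewrite taylorS !fctE.
apply: is_derive_eq; rewrite taylorS; congr (_ + _).
by rewrite -dc /= /GRing.scale /= mulr1 mulrA mulr_natr.
Qed.

(** The remainder of [f] of order [n] is the derivative of the remainder of [g] of order [n + 1], so
    the mean value theorem raises the bound by one power of [|x|]. Applied to the logarithmic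
    derivative, this makes [ln] of a positive analytic function analytic without composing
    series. *)
Lemma analytic_primitive f g t : deriv_near g f t -> analytic f t -> analytic g t.
Proof.
move=> [e e0 df] [c [C [M [r [C0 M0 r0 H K]]]]].
pose d k := if k is k'.+1 then c k' / k'.+1%:R else g t.
have dc k : d k.+1 *+ k.+1 = c k by rewrite /d -[LHS]mulr_natr divfK // pnatr_eq0.
exists d; pose e' := Num.min e r.
have e'0 : 0 < e' by rewrite lt_min e0.
(* The first two summands serve order 0; the last one rewrites [C |x| (M |x|) ^ n] as [C / M] times
   [(M |x|) ^ (n + 1)]. *)
pose E := `|g t| + C * e' + C / M.
have CM : 0 < C / M by rewrite divr_gt0.
have gt0 := normr_ge0 (g t).
have Ce : 0 < C * e' by rewrite mulr_gt0.
have E0 : 0 < E by rewrite /E; lra.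
apply: (@jet_remainder _ _ _ _ E M e') => // n x xe'.
have lt_e (y : R) : `|y| < e' -> `|y| < e by rewrite lt_min => /andP[].
have lt_r (y : R) : `|y| < e' -> `|y| < r by rewrite lt_min => /andP[].
have main n' : `|g (t + x) - taylor d n'.+1 x| <= C * (M * `|x|) ^+ n' * `|x|.
  have [|y yx] := @mvt_ball (fun y => g (t + y) - taylor d n'.+1 y)
     (fun y => f (t + y) - taylor c n' y) e' x _ xe'.
    move=> y ye'; have := df y (lt_e _ ye'); have := is_derive_taylor n' y dc => h1 h2.
    exact: is_deriveB.
  rewrite addr0 {2}/taylor big_ord_recl /= expr0 mulr1 big1 ?addr0 ?subrr ?subr0; last first.
    by move=> i _; rewrite /bump /= expr0n /= mulr0.
  move=> ->; rewrite normrM; apply: ler_wpM2r => //.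
  have yr : `|y| < r by apply: le_lt_trans yx _; exact: lt_r xe'.
  apply: le_trans (H n' y yr) _; rewrite ler_pM2l //; apply: lerXn2r.
  - by rewrite nnegrE mulr_ge0 // ltW.
  - by rewrite nnegrE mulr_ge0 // ltW.
  - by rewrite ler_pM2l.
case: n => [|n].
  have := main 0%N; rewrite taylorS !taylor0 add0r !expr0 !mulr1 subr0 /= => h.
  have h2 : C * `|x| <= C * e' by rewrite ler_pM2l // ltW.
  have h3 := ler_normD (g (t + x) - g t) (g t).
  rewrite subrK in h3; rewrite /E; lra.
apply: le_trans (main n) _.
have -> : C * (M * `|x|) ^+ n * `|x| = C / M * (M * `|x|) ^+ n.+1.
  rewrite exprS; field; exact: lt0r_neq0.
apply: ler_wpM2r; first by rewrite exprn_ge0 // mulr_ge0 // ltW.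
rewrite /E; lra.
Qed.

Lemma analytic_lip f t : analytic f t -> exists C e : R, [/\ 0 < C, 0 < e &
  forall x, `|x| < e -> `|f (t + x) - f t| <= C * `|x|].
Proof.
move=> [c jf]; have ft := jet_val jf.
have [C [M [r [C0 M0 r0 H K]]]] := jf.
exists (C * M), r; split => //; first exact: mulr_gt0.
move=> x xr; have := H 1%N x xr.
by rewrite taylorS taylor0 add0r expr0 mulr1 expr1 mulrA ft.
Qed.

Lemma analytic_gt f t (a : R) : analytic f t -> a < f t ->
  exists2 e : R, 0 < e & forall x, `|x| < e -> a < f (t + x).
Proof.
move=> /analytic_lip[C [e [C0 e0 H]]] ft.
exists (Num.min e ((f t - a) / C)); first by rewrite lt_min e0 divr_gt0 // subr_gt0.
move=> x; rewrite lt_min => /andP[xe]; rewrite ltr_pdivlMr // mulrC => xC.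
have := H x xe; rewrite ler_norml => /andP[h _].
have h3 : - (C * `|x|) <= f (t + x) - f t by [].
lra.
Qed.

Lemma analytic_neq0 f t : analytic f t -> f t != 0 ->
  exists2 e : R, 0 < e & forall x, `|x| < e -> f (t + x) != 0.
Proof.
move=> af; rewrite neq_lt => /orP[f0|f0].
  have [|e e0 H] := @analytic_gt (fun s => -1 * f s) t 0 (analyticZ _ af); first lra.
  by exists e => // x /H h; rewrite lt_eqF //; lra.
by have [e e0 H] := analytic_gt af f0; exists e => // x /H h; rewrite gt_eqF.
Qed.

Lemma analytic_ln f t : analytic f t -> 0 < f t -> analytic (fun s => ln (f s)) t.
Proof.
move=> af ft.
have [e e0 fp] := analytic_gt af ft.
have [g ag [e' e'0 dg]] := analytic_derive af.
apply: (@analytic_primitive (fun s => (f s)^-1 * g s)); last first.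
  by apply: analyticM => //; apply: analytic_inv => //; exact: lt0r_neq0.
exists (Num.min e e'); first by rewrite lt_min e0.
move=> x; rewrite lt_min => /andP[/fp fx /dg dx].
have h := @is_derive1_comp _ (@ln R) (fun y => f (t + y)) x _ _ (is_derive1_ln fx) dx.
exact: h.
Qed.

(** The first nonzero Taylor coefficient, if there is one, beats the next remainder at small [x];
    otherwise the series sums to 0. *)
Lemma analytic_dichotomy f t : analytic f t ->
  (exists2 e : R, 0 < e & forall x, `|x| < e -> f (t + x) = 0) \/
  (exists2 e : R, 0 < e & forall x, x != 0 -> `|x| < e -> f (t + x) != 0).
Proof.
move=> [c jf]; have [C [M [r [C0 M0 r0 H K]]]] := jf.
have [c0|/existsNP/cid[n cn]] := pselect (forall n, c n = 0).
  left; have [e e0 fE] := jet_lim jf; exists e => // x /fE ->.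
  rewrite pseriesE (_ : (fun n => _) = cst 0) ?lim_cst //.
  apply/funext => n; rewrite /taylor big1 // => i _.
  by rewrite c0 mul0r.
right.
have exn : exists n, c n != 0 by exists n; apply/eqP.
have [k ck kmin] := ex_minnP exn.
have tk x : taylor c k.+1 x = c k * x ^+ k.
  rewrite taylorS /taylor big1 ?add0r // => i _.
  have [->|/kmin] := eqVneq (c i) 0; first by rewrite mul0r.
  by rewrite leqNgt ltn_ord.
exists (Num.min r (`|c k| / (C * M ^+ k.+1))).
  by rewrite lt_min r0 divr_gt0 ?normr_gt0 // mulr_gt0 // exprn_gt0.
move=> x x0; rewrite lt_min => /andP[xr].
rewrite ltr_pdivlMr; last by rewrite mulr_gt0 // exprn_gt0.
move=> h; apply/eqP => fx0.
have := H k.+1 x xr; rewrite fx0 tk sub0r normrN normrM normrX exprMn exprS.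
rewrite [_ ^+ k.+1]exprS.
have -> : C * (M * M ^+ k * (`|x| * `|x| ^+ k)) = `|x| * (C * M ^+ k.+1) * `|x| ^+ k.
  by rewrite exprS; ring.
by rewrite ler_pM2r ?exprn_gt0 ?normr_gt0 // leNgt h.
Qed.

Lemma jet_div f t c : jet f t c -> c 0%N = 0 ->
  exists2 g, jet g t (fun k => c k.+1) & forall x, f (t + x) = x * g (t + x).
Proof.
move=> jf c0; have ft := jet_val jf; have [C [M [r [C0 M0 r0 H K]]]] := jf.
exists (fun s => if s == t then c 1%N else f s / (s - t)).
  apply: (@jet_remainder _ _ _ _ (C * M) M r) => //; first exact: mulr_gt0.
  move=> n x xr; rewrite -subr_eq0 (addrC t) addrK.
  have [->|x0] := eqVneq x 0.
    case: n => [|n].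
      rewrite taylor0 subr0 expr0 mulr1; have := K 1%N.
      by rewrite expr1.
    rewrite /taylor big_ord_recl expr0 mulr1 big1 ?addr0 ?subrr ?normr0.
      by rewrite mulr0 mulr_ge0 ?exprn_ge0 // mulr_ge0 // ltW.
    by move=> i _; rewrite /bump /= expr0n /= mulr0.
  have nx0 : 0 < `|x| by rewrite normr_gt0.
  rewrite -(ler_pM2r nx0) -normrM mulrBl divfK //.
  have -> : taylor (fun k => c k.+1) n x * x = taylor c n.+1 x.
    rewrite [RHS]/taylor big_ord_recl c0 mul0r add0r mulr_suml.
    by apply: eq_bigr => i _; rewrite lift0 exprSr mulrA.
  rewrite addrC; apply: le_trans (H n.+1 x xr) _.
  by rewrite exprS le_eqVlt; apply/orP; left; apply/eqP; ring.
move=> x; rewrite -subr_eq0 (addrC t) addrK; have [->|x0] := eqVneq x 0.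
  by rewrite mul0r add0r ft.
by rewrite mulrC divfK // addrC.
Qed.

End AnalyticCalculus.

(** * Logarithmic singularities *)

Section Singular.
Context {R : realType}.
Implicit Types (f g : R -> R) (t : R) (c d : nat -> R).

(** The fourth root [w] of [|x|] is the unit in which logarithms are absorbed: one factor [w] bounds
    one logarithm by 4, so [|x| = w ^ 4] pays for a squared logarithm and leaves [w ^ 2] over. *)
Lemma root4 (x : R) : 0 < x -> exists2 w : R, 0 < w & w ^+ 4 = x.
Proof.
move=> x0; exists (Num.sqrt (Num.sqrt x)); first by rewrite !sqrtr_gt0.
by rewrite (exprM _ 2 2) !sqr_sqrtr ?sqrtr_ge0 // ltW.
Qed.

(** Once the exponent 4 is pulled out, this is [ln y < y] at [y = w^-1]. *)
Lemma ln_root4_bound (w : R) : 0 < w -> w <= 1 -> w * `|ln (w ^+ 4)| <= 4.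
Proof.
move=> w0 w1; have -> : ln (w ^+ 4) = 4 * ln w by rewrite lnXn // mulr_natl.
rewrite normrM ger0_norm // ler0_norm ?ln_le0 //.
rewrite -lnV ?posrE // mulrCA -[leRHS]mulr1 ler_pM2l //.
have := @ln_sublinear R w^-1; rewrite invr_gt0 => /(_ w0) h.
by rewrite -(mulfV (lt0r_neq0 w0)) ler_pM2l // ltW.
Qed.

Lemma analytic_bounded f t : analytic f t -> exists B e : R,
  [/\ 0 < B, 0 < e & forall x, `|x| < e -> `|f (t + x)| <= B].
Proof.
move=> [c [C [M [r [C0 M0 r0 H _]]]]]; exists C, r; split => // x xr.
by have := H 0%N x xr; rewrite taylor0 subr0 expr0 mulr1.
Qed.

Definition punctured_near (P : R -> Prop) t :=
  exists2 e : R, 0 < e & forall x, x != 0 -> `|x| < e -> P (t + x).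

(** The log terms are of order at least [m], the order of the term linear in
    the logarithm; below that order the Taylor coefficients of [A] decide. *)
Lemma log_expansion_neq0 (F A B G : R -> R) t (m : nat) :
  analytic A t -> analytic B t -> analytic G t -> B t != 0 ->
  punctured_near (fun s => F s = A s + (s - t) ^+ m * B s * ln `|s - t|
    + (s - t) ^+ m.+1 * G s * ln `|s - t| ^+ 2) t ->
  punctured_near (fun s => F s != 0) t.
Proof.
move=> aA aB aG B0 [e0 e00 FE].
have [c jA] := aA.
have [C [M [r [C0 M0 r0 H K]]]] := jA.
have [bB [eB [bB0 eB0 HB]]] := analytic_bounded aB.
have [bG [eG [bG0 eG0 HG]]] := analytic_bounded aG.
have [b [b0 [eb eb0 Hb]]] : exists b : R, 0 < b /\
    exists2 e : R, 0 < e & forall x, `|x| < e -> b < `|B (t + x)|.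
  exists (`|B t| / 2); split; first by rewrite divr_gt0 // normr_gt0.
  have nB : 0 < `|B t| by rewrite normr_gt0.
  have [|e e1 He] := @analytic_gt _ (fun s => B s ^+ 2) t ((`|B t| / 2) ^+ 2) (analyticX 2 aB).
    by rewrite -[ltRHS]real_normK ?num_real // ltr_pXn2r // ?nnegrE; lra.
  exists e => // x /He; rewrite -[X in _ < X]real_normK ?num_real //.
  by rewrite ltr_pXn2r // nnegrE; lra.
pose e1 := Num.min (Num.min e0 r) (Num.min (Num.min eB eG) (Num.min eb 1)).
have e10 : 0 < e1 by rewrite !lt_min e00 r0 eB0 eG0 eb0 ltr01.
have E x : x != 0 -> `|x| < e1 -> exists w : R, [/\ 0 < w, w <= 1, w ^+ 4 = `|x|,
    w * `|ln `|x| | <= 4 & [/\ `|x| < r,  b < `|B (t + x)|, `|B (t + x)| <= bB,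
      `|G (t + x)| <= bG & F (t + x) = A (t + x) + x ^+ m * B (t + x) * ln `|x|
    + x ^+ m.+1 * G (t + x) * ln `|x| ^+ 2]].
  move=> x0; rewrite !lt_min => /andP[/andP[xe0 xr] /andP[/andP[xB xG] /andP[xb x1]]].
  have [w w0 wx] : exists2 w : R, 0 < w & w ^+ 4 = `|x| by apply: root4; rewrite normr_gt0.
  have w1 : w <= 1.
    rewrite -(ler_pXn2r (n := 4)) ?nnegrE ?(ltW w0) // wx expr1n; exact: ltW.
  exists w; split => //; first by rewrite -wx; exact: ln_root4_bound.
  split; [by []|exact: Hb|exact: HB|exact: HG|].
  by rewrite FE // (addrC t) addrK.
have [allz|/existsNP/cid[n /not_implyP[nm /eqP cn]]] :=
    pselect (forall k, (k < m)%N -> c k = 0).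
  (* Here [|A|] is at most [C M ^ m |x| ^ m] and the squared logarithm contributes at most
     [16 bG |x| ^ m], where [16 = 4 ^ 2]. Since [|x| < expR (- T)] gives [|ln |x|| > T], the linear
     logarithm exceeds both together. *)
  pose T := (C * M ^+ m + 16 * bG) / b.
  have T0 : 0 < T.
    by rewrite divr_gt0 // addr_gt0 // mulr_gt0 // exprn_gt0.
  exists (Num.min e1 (expR (- T))); first by rewrite lt_min e10 expR_gt0.
  move=> x x0; rewrite lt_min => /andP[xe1 xT].
  have [w [w0 w1 wx lw [xr Bb BB GG ->]]] := E x x0 xe1.
  have nx0 : 0 < `|x| by rewrite normr_gt0.
  have lnT : T < `|ln `|x| |.
    have : ln `|x| < - T by rewrite -[- T]expRK ltr_ln ?posrE // expR_gt0.
    move=> h; rewrite ltr0_norm; lra.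
  apply/eqP => /eqP; rewrite addrAC addrC addr_eq0 => /eqP h.
  have : `|x| ^+ m * (b * `|ln `|x| |) <= `|x| ^+ m * (C * M ^+ m + 16 * bG).
    apply: (@le_trans _ _ `|x ^+ m * B (t + x) * ln `|x| |).
      rewrite !normrM normrX -mulrA ler_pM2l ?exprn_gt0 //.
      by apply: ler_wpM2r => //; exact: ltW.
    rewrite h normrN mulrDr; apply: le_trans (ler_normD _ _) _; apply: lerD.
      have := H m x xr; rewrite /taylor big1 => [|i _]; last first.
        by rewrite allz // mul0r.
      by rewrite subr0 exprMn mulrA mulrC.
    rewrite !normrM !normrX exprS.
    have -> : `|x| * `|x| ^+ m * `|G (t + x)| * `|ln `|x| | ^+ 2 =
      `|x| ^+ m * ((w * `|ln `|x| |) ^+ 2 * (w ^+ 2 * `|G (t + x)|)).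
      rewrite -[X in X * `|x| ^+ m]wx; ring.
    rewrite ler_pM2l ?exprn_gt0 //; apply: ler_pM => //.
    - by rewrite exprn_ge0 // mulr_ge0 // ltW.
    - by rewrite mulr_ge0 // exprn_ge0 // ltW.
    - have : (w * `|ln `|x| |) ^+ 2 <= 4 ^+ 2.
        by apply: lerXn2r => //; rewrite nnegrE // mulr_ge0 // ltW.
      by move/le_trans; apply; rewrite -natrX.
    - rewrite -[leRHS]mul1r; apply: ler_pM => //; first by rewrite exprn_ge0 // ltW.
      by rewrite exprn_ile1 // ltW.
  rewrite ler_pM2l ?exprn_gt0 // leNgt => /negP; apply.
  by rewrite [ltRHS]mulrC -ltr_pdivrMr.
have exn : exists n, c n != 0 by exists n.
have [k ck kmin] := ex_minnP exn.
have km : (k < m)%N by apply: leq_ltn_trans (kmin n cn) nm.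
have tk x : taylor c k.+1 x = c k * x ^+ k.
  rewrite taylorS /taylor big1 ?add0r // => i _.
  have [->|/kmin] := eqVneq (c i) 0; first by rewrite mul0r.
  by rewrite leqNgt ltn_ord.
(* Now the coefficient [c k], with [k < m], dominates. Each of the other three contributions has a
   spare factor [|x| = w ^ 4], enough to absorb its logarithms and still leave one [w]; the radius
   [q ^+ 4] means [w < |c k| / T]. *)
pose T := C * M ^+ k.+1 + 4 * bB + 16 * bG.
have T0 : 0 < T.
  have : 0 < C * M ^+ k.+1 by rewrite mulr_gt0 // exprn_gt0.
  rewrite /T; lra.
pose q := `|c k| / T.
have q0 : 0 < q by rewrite divr_gt0 // normr_gt0.
exists (Num.min e1 (q ^+ 4)); first by rewrite lt_min e10 exprn_gt0.
move=> x x0; rewrite lt_min => /andP[xe1 xT].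
have [w [w0 w1 wx lw [xr Bb BB GG ->]]] := E x x0 xe1.
have nx0 : 0 < `|x| by rewrite normr_gt0.
have wq : w < q.
  by rewrite -wx ltr_pXn2r ?nnegrE ?ltW // in xT.
have w1' n' : w ^+ n'.+1 <= w.
  rewrite exprS ler_piMr ?(ltW w0) //.
  by apply: exprn_ile1 => //; exact: ltW.
apply/eqP => h.
have : `|x| ^+ k * `|c k| <= `|x| ^+ k * (T * w).
  have -> : `|x| ^+ k * `|c k| = `|c k * x ^+ k| by rewrite normrM normrX mulrC.
  have -> : c k * x ^+ k = - ((A (t + x) - taylor c k.+1 x) +
     (x ^+ m * B (t + x) * ln `|x| + x ^+ m.+1 * G (t + x) * ln `|x| ^+ 2)).
    rewrite tk; apply/eqP; rewrite -subr_eq0 opprK -[X in _ == X]h; apply/eqP; ring.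
  rewrite normrN; apply: le_trans (ler_normD _ _) _.
  have -> : `|x| ^+ k * (T * w) = `|x| ^+ k * (C * M ^+ k.+1 * w) +
     (`|x| ^+ k * (4 * bB * w) + `|x| ^+ k * (16 * bG * w)) by rewrite /T; ring.
  have xm : `|x| ^+ m <= `|x| ^+ k.+1.
    apply: ler_wiXn2l => //; rewrite -wx exprn_ile1 // ltW //.
  apply: lerD.
    apply: le_trans (H k.+1 x xr) _; rewrite exprMn (exprS `|x|).
    have -> : C * (M ^+ k.+1 * (`|x| * `|x| ^+ k)) = `|x| ^+ k * (C * M ^+ k.+1 * w ^+ 4).
      rewrite wx; ring.
    rewrite ler_pM2l ?exprn_gt0 // ler_pM2l ?mulr_gt0 ?exprn_gt0 //.
  apply: le_trans (ler_normD _ _) _; apply: lerD.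
    rewrite !normrM normrX.
    apply: (@le_trans _ _ (`|x| ^+ k.+1 * bB * `|ln `|x| |)).
      by apply: ler_wpM2r => //; apply: ler_pM.
    have -> : `|x| ^+ k.+1 * bB * `|ln `|x| | =
       `|x| ^+ k * (bB * ((w * `|ln `|x| |) * w ^+ 3)).
      rewrite exprS -[X in X * _ * bB]wx; ring.
    rewrite ler_pM2l ?exprn_gt0 // (mulrC 4) -[leRHS]mulrA ler_pM2l //.
    apply: ler_pM => //; first by rewrite mulr_ge0 // ltW.
    by rewrite exprn_ge0 // ltW.
  rewrite !normrM !normrX.
  apply: (@le_trans _ _ (`|x| * `|x| ^+ k.+1 * bG * `|ln `|x| | ^+ 2)).
    rewrite (exprS _ m); apply: ler_wpM2r; first exact: mulr_ge0.
    by apply: ler_pM => //; rewrite ?mulr_ge0 ?exprn_ge0 // ler_pM2l.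
  have -> : `|x| * `|x| ^+ k.+1 * bG * `|ln `|x| | ^+ 2 =
     `|x| ^+ k * (bG * ((w * `|ln `|x| |) ^+ 2 * w ^+ 6)).
    have -> : w ^+ 6 = w ^+ 2 * w ^+ 4 by rewrite -exprD.
    have -> : `|x| * `|x| ^+ k.+1 * bG * `|ln `|x| | ^+ 2 =
      w ^+ 4 * w ^+ 4 * `|x| ^+ k * bG * `|ln `|x| | ^+ 2 by rewrite exprS wx; ring.
    ring.
  rewrite ler_pM2l ?exprn_gt0 // (mulrC 16) -[leRHS]mulrA ler_pM2l //.
  apply: ler_pM => //; first by rewrite exprn_ge0 // mulr_ge0 // ltW.
    by rewrite exprn_ge0 // ltW.
  have : (w * `|ln `|x| |) ^+ 2 <= 4 ^+ 2.
    by apply: lerXn2r => //; rewrite nnegrE // mulr_ge0 // ltW.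
  by move/le_trans; apply; rewrite -natrX.
rewrite ler_pM2l ?exprn_gt0 // leNgt => /negP; apply.
by rewrite [ltLHS]mulrC -ltr_pdivlMr.
Qed.

End Singular.

(** * Kernel matrices *)

Section Kernel.
Context {R : realType}.
Implicit Types (f g : R -> R) (t : R) (c d : nat -> R).

Definition sqd (A Q : R * R) : R := (Q.1 - A.1) ^+ 2 + (Q.2 - A.2) ^+ 2.

Lemma sqdC A Q : sqd A Q = sqd Q A.
Proof. by rewrite /sqd; ring. Qed.

Lemma sqd0 A : sqd A A = 0.
Proof. by rewrite /sqd !subrr expr0n addr0. Qed.

Lemma sqd_ge0 A Q : 0 <= sqd A Q.
Proof. by rewrite addr_ge0 // sqr_ge0. Qed.

Lemma sqd_gt0 A Q : (0 < sqd A Q) = (A != Q).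
Proof.
rewrite lt_neqAle sqd_ge0 andbT eq_sym /sqd paddr_eq0 ?sqr_ge0 // !sqrf_eq0 !subr_eq0.
by case: A Q => [a1 a2] [q1 q2] /=; rewrite xpair_eqE eq_sym (eq_sym q2).
Qed.

Definition log_kernel (w : nat * R * R) (z : R) : R :=
  z ^+ w.1.1 * (w.1.2 * ln z + w.2).

(** The positive exponent makes the kernel vanish at its centre; the nonzero coefficient makes its
    logarithm genuine. *)
Definition admissible (w : nat * R * R) := (0 < w.1.1)%N && (w.1.2 != 0).

Lemma log_kernel0 w : admissible w -> log_kernel w 0 = 0.
Proof. by move=> /andP[k0 _]; rewrite /log_kernel expr0n gtn_eqF // mul0r. Qed.

(** The coefficients of index 1 are the components of the velocity. *)
Definition regular_at (g : R -> R * R) t := exists c d,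
  [/\ jet (fst \o g) t c, jet (snd \o g) t d & (c 1%N != 0) || (d 1%N != 0)].

Lemma analytic_sqd (g : R -> R * R) t A : analytic (fst \o g) t -> analytic (snd \o g) t ->
  analytic (fun s => sqd A (g s)) t.
Proof.
by move=> a1 a2; apply: analyticD; apply: analyticX; apply: analyticD => //; exact: analytic_cst.
Qed.

Lemma analytic_log_kernel w f t : analytic f t -> 0 < f t ->
  analytic (fun s => log_kernel w (f s)) t.
Proof.
move=> af ft; apply: analyticM; first exact: analyticX.
by apply: analyticD; [apply: analyticZ; exact: analytic_ln | exact: analytic_cst].
Qed.

Lemma regular_analytic (g : R -> R * R) t :
  regular_at g t -> analytic (fst \o g) t /\ analytic (snd \o g) t.
Proof. by move=> [c [d [jc jd _]]]; split; [exists c | exists d]. Qed.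

(** Both components of [g (t + x) - g t] are divisible by [x]; the quotients at [t] form the
    velocity, so [h t] is the squared speed. *)
Lemma sqd_regular (g : R -> R * R) t : regular_at g t ->
  exists h, [/\ analytic h t, 0 < h t & forall x, sqd (g t) (g (t + x)) = x ^+ 2 * h (t + x)].
Proof.
move=> [c [d [jc jd cd]]].
have key (f : R -> R) e : jet f t e ->
    exists2 f1, jet f1 t (fun k => e k.+1) & forall x, f (t + x) - f t = x * f1 (t + x).
  move=> je; have je2 := jetD je (jet_cst (- f t) t).
  have [|f1 jf1 E] := jet_div je2; first by rewrite /= (jet_val je) subrr.
  exists f1; last exact: E.
  by congr (jet f1 t _) : jf1; apply/funext => k /=; rewrite addr0.
have [f1 j1 E1] := key _ _ jc; have [f2 j2 E2] := key _ _ jd.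
exists (fun s => f1 s ^+ 2 + f2 s ^+ 2); split.
- by apply: analyticD; apply: analyticX; [exists (fun k => c k.+1) | exists (fun k => d k.+1)].
- rewrite (jet_val j1) (jet_val j2) lt_neqAle addr_ge0 ?sqr_ge0 // andbT eq_sym.
  by rewrite paddr_eq0 ?sqr_ge0 // !sqrf_eq0 negb_and.
- move=> x; rewrite /sqd; move: (E1 x) (E2 x) => /= -> ->; ring.
Qed.

Lemma punctured_and (P Q : R -> Prop) t :
  punctured_near P t -> punctured_near Q t -> punctured_near (fun s => P s /\ Q s) t.
Proof.
move=> [e e0 HP] [e' e'0 HQ]; exists (Num.min e e'); first by rewrite lt_min e0.
by move=> x x0; rewrite lt_min => /andP[xe xe']; split; [exact: HP | exact: HQ].
Qed.

Lemma punctured_sub (P Q : R -> Prop) t :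
  (forall s, P s -> Q s) -> punctured_near P t -> punctured_near Q t.
Proof. by move=> PQ [e e0 HP]; exists e => // x x0 xe; apply: PQ; exact: HP. Qed.

(** Writing the squared distance as [x ^ 2 h] splits its logarithm into [2 ln |x| + ln h], and
    [ln h] is analytic because [h t] is positive. *)
Lemma log_kernel_regular w (g : R -> R * R) t : regular_at g t -> admissible w ->
  exists a b, [/\ analytic a t, analytic b t, b t != 0 &
    punctured_near (fun s => log_kernel w (sqd (g t) (g s)) =
       (s - t) ^+ (2 * w.1.1) * (a s + b s * ln `|s - t|)) t].
Proof.
move=> /sqd_regular[h [ah h0 E]] /andP[k0 al0].
have [e e0 hp] := analytic_gt ah h0.
exists (fun s => h s ^+ w.1.1 * (w.1.2 * ln (h s) + w.2)), (fun s => 2 * w.1.2 * h s ^+ w.1.1).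
split.
- exact: analytic_log_kernel.
- by apply: analyticZ; exact: analyticX.
- by rewrite !mulf_neq0 // expf_neq0 // lt0r_neq0.
exists e => // x x0 xe; rewrite /log_kernel E (addrC t) addrK.
have hx := hp x xe; rewrite addrC in hx.
have nx0 : 0 < `|x| by rewrite normr_gt0.
have -> : x ^+ 2 = `|x| ^+ 2 by rewrite real_normK // num_real.
rewrite lnM ?posrE ?exprn_gt0 // lnXn // exprMn -exprM.
have -> : `|x| ^+ (2 * w.1.1) = x ^+ (2 * w.1.1).
  by rewrite !exprM real_normK // num_real.
by rewrite -mulr_natl; ring.
Qed.

(** Expanding the square, [ln ^ 2] carries the power [2 m], which is at least [m + 1] since [0 < m],
    as [log_expansion_neq0] requires. In the coefficient of the simple logarithm the cross term of
    the square vanishes at [t], which leaves [b t * P t]. *)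
Lemma log_quadratic_neq0 (F a b P Q : R -> R) (q : R) t m : (0 < m)%N ->
  analytic a t -> analytic b t -> analytic P t -> analytic Q t -> b t != 0 -> P t != 0 ->
  punctured_near (fun s => F s = Q s + (s - t) ^+ m * (a s + b s * ln `|s - t|) * P s
     + q * ((s - t) ^+ m * (a s + b s * ln `|s - t|)) ^+ 2) t ->
  punctured_near (fun s => F s != 0) t.
Proof.
case: m => // m _ aa ab aP aQ b0 P0 FE.
have av n : analytic (fun s => (s - t) ^+ n) t.
  by apply: analyticX; eexists; exact: jet_var.
apply: (@log_expansion_neq0 _ F
  (fun s => Q s + (s - t) ^+ m.+1 * a s * P s + q * ((s - t) ^+ m.+1 * a s) ^+ 2)
  (fun s => b s * P s + 2 * q * ((s - t) ^+ m.+1 * a s * b s))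
  (fun s => q * ((s - t) ^+ m * b s ^+ 2)) t m.+1).
- do 2?[apply: analyticD] => //; first by do 2?[apply: analyticM].
  by apply: analyticZ; apply: analyticX; exact: analyticM.
- apply: analyticD; first exact: analyticM.
  by apply: analyticZ; do 2?[apply: analyticM].
- by apply: analyticZ; apply: analyticM => //; exact: analyticX.
- by rewrite subrr expr0n /= !mul0r mulr0 addr0 mulf_neq0.
by apply: punctured_sub FE => s ->; rewrite !exprS; ring.
Qed.

Section KernelMatrix.
Variable w : bool -> nat * R * R.
Hypothesis w_adm : forall b, admissible (w b).

(** The row node selects the kernel and the column node is its centre, so mixed types break
    symmetry. Nodes are indexed by [nat], which lets a new one be prepended without changing the
    type of [p]. *)
Definition kernel_mx N (p : nat -> bool * (R * R)) : 'M[R]_N :=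
  \matrix_(i < N, j < N) log_kernel (w (p i).1) (sqd (p j).2 (p i).2).

Definition pcons (z : bool * (R * R)) (p : nat -> bool * (R * R)) (i : nat) :=
  if i is j.+1 then p j else z.

Lemma kernel_mx_cons N z p : kernel_mx N.+1 (pcons z p) =
  block_mx (0 : 'M[R]_1)
    (\row_(j < N) log_kernel (w z.1) (sqd (p j).2 z.2))
    (\col_(i < N) log_kernel (w (p i).1) (sqd z.2 (p i).2))
    (kernel_mx N p) :> 'M[R]_(1 + N).
Proof.
apply/matrixP => i j; rewrite !mxE.
case: splitP => [i' | i' ] -> ; rewrite !mxE; case: splitP => [j' | j'] -> ; rewrite !mxE;
  rewrite ?(ord1 i') ?(ord1 j') //=.
by rewrite sqd0 log_kernel0.
Qed.

Lemma det_bordered N (u : 'rV[R]_N) (v : 'cV[R]_N) (K : 'M[R]_N) : K \in unitmx ->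
  \det (block_mx 0 u v K : 'M[R]_(1 + N)) = - ((u *m invmx K *m v) 0 0) * \det K.
Proof.
move=> uK.
have -> : block_mx (0 : 'M[R]_1) u v K =
   block_mx 1%:M (u *m invmx K) 0 1%:M *m block_mx (- (u *m invmx K *m v)) 0 v K.
  rewrite mulmx_block !mul1mx !mul0mx !add0r addNr; congr block_mx.
  by rewrite mulmxKV.
rewrite det_mulmx det_ublock !det1 !mul1r det_lblock; congr (_ * _).
by rewrite {1}[- _]mx11_scalar det_scalar1 mxE.
Qed.

Lemma kernel_mx_cons_neq0 N z p : kernel_mx N p \in unitmx ->
  (\det (kernel_mx N.+1 (pcons z p)) != 0) =
  (\sum_(i < N) \sum_(j < N) log_kernel (w z.1) (sqd (p i).2 z.2) *
     invmx (kernel_mx N p) i j * log_kernel (w (p j).1) (sqd z.2 (p j).2) != 0).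
Proof.
move=> uK; have dK : \det (kernel_mx N p) != 0 by rewrite -unitfE -unitmxE.
rewrite kernel_mx_cons det_bordered // mulf_eq0 negb_or dK andbT oppr_eq0; congr (_ != 0).
rewrite mxE exchange_big; apply: eq_bigr => j _.
by rewrite mxE mulr_suml; apply: eq_bigr => i _; rewrite !mxE.
Qed.

(** Equal points give equal columns. *)
Lemma kernel_mx_unit_inj N p (i j : 'I_N) : kernel_mx N p \in unitmx ->
  (p i).2 = (p j).2 -> i = j.
Proof.
move=> uK pij; apply/eqP; apply: contraLR uK => ij.
rewrite unitmxE unitfE negbK -det_tr; apply/eqP.
by apply: (determinant_alternate ij) => k; rewrite !mxE pij.
Qed.

(** Quantifying over all regular curves serves two uses: the boundary curve itself, and a vertical
    line through an interior node. *)
Definition nonvanishing_at N p b (x : R * R) := forall (g : R -> R * R) t,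
  regular_at g t -> g t = x ->
  punctured_near (fun s => \det (kernel_mx N.+1 (pcons (b, g s) p)) != 0) t.

Lemma nonvanishing_add N p (i0 : 'I_N) : kernel_mx N p \in unitmx ->
  nonvanishing_at N p (p i0).1 (p i0).2.
Proof.
move=> uK g t rg gt; set b := (p i0).1.
pose K := kernel_mx N p; pose V := invmx K.
have [a [c [aa ac c0 E]]] := log_kernel_regular rg (w_adm b).
rewrite gt in E.
have [ag1 ag2] := regular_analytic rg.
pose L (b' : bool) (j : 'I_N) s := log_kernel (w b') (sqd (p j).2 (g s)).
have aL b' (j : 'I_N) : j != i0 -> analytic (L b' j) t.
  move=> ji0; apply: analytic_log_kernel; first exact: analytic_sqd.
  rewrite gt sqd_gt0; apply: contraNneq ji0 => pj.
  by apply/eqP; exact: kernel_mx_unit_inj pj.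
(* The bordered determinant is quadratic in the singular entry [L b i0]: [V i0 i0] multiplies its
   square, [P] is the linear coefficient and [Q] the rest. The other entries are analytic at [t], as
   the remaining nodes differ from [g t]. *)
pose P s := \sum_(j < N | j != i0) V i0 j * L (p j).1 j s +
            \sum_(i < N | i != i0) V i i0 * L b i s.
pose Q s := \sum_(i < N | i != i0) \sum_(j < N | j != i0) V i j * (L b i s * L (p j).1 j s).
(* The entry [L (p j).1 j t] is [K j i0] in any case, while [L b i t] is [K i0 i] only because [b]
   is the type of the node [i0]. *)
have P2 : P t = 2.
  have Kii : K i0 i0 = 0 by rewrite mxE sqd0 log_kernel0.
  have e1 : \sum_(j < N | j != i0) V i0 j * L (p j).1 j t = 1.
    have := mulVmx uK => /matrixP /(_ i0 i0); rewrite !mxE eqxx mulr1n.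
    rewrite (bigD1 i0) //= -/K Kii mulr0 add0r => <-; apply: eq_bigr => j _.
    by rewrite mxE /L gt sqdC.
  have e2 : \sum_(i < N | i != i0) V i i0 * L b i t = 1.
    have := mulmxV uK => /matrixP /(_ i0 i0); rewrite !mxE eqxx mulr1n.
    rewrite (bigD1 i0) //= -/K Kii mul0r add0r => <-; apply: eq_bigr => j _.
    by rewrite mxE /L gt mulrC.
  by rewrite /P e1 e2.
apply: (@punctured_sub (fun s => \sum_(i < N) \sum_(j < N) L b i s * V i j * L (p j).1 j s != 0)).
  move=> s; rewrite kernel_mx_cons_neq0 // => h; congr (_ != 0) : h.
  by apply: eq_bigr => i _; apply: eq_bigr => j _; rewrite /L (sqdC (g s)).
apply: (@log_quadratic_neq0 _ a c P Q (V i0 i0) t (2 * (w b).1.1)) => //.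
- by rewrite muln_gt0 /=; case/andP: (w_adm b).
- apply: analyticD; apply: analytic_sum => j ji; apply: analyticZ; exact: aL.
- apply: analytic_sum => i ii; apply: analytic_sum => j ji.
  by apply: analyticZ; apply: analyticM; exact: aL.
- by rewrite P2.
apply: punctured_sub E => s E; rewrite -E -/(L b i0 s).
rewrite (bigD1 i0) //= (bigD1 i0) //=.
rewrite [X in _ + X = _](_ : _ =
    \sum_(i < N | i != i0) (V i i0 * L b i s) * L b i0 s + Q s); last first.
  rewrite -big_split; apply: eq_bigr => i ii /=; rewrite (bigD1 i0) //=; congr (_ + _).
    by rewrite /b; ring.
  by apply: eq_bigr => j jj; ring.
rewrite /P mulrDr mulr_sumr -mulr_suml.
have -> : \sum_(i < N | i != i0) L b i0 s * V i0 i * L (p i).1 i s =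
   \sum_(i < N | i != i0) L b i0 s * (V i0 i * L (p i).1 i s).
  by apply: eq_bigr => i ii; ring.
rewrite /b; ring.
Qed.

(** One node gives the zero matrix of size 1, to which bordering does not apply. The determinant of
    size 2 is minus the product of its off-diagonal entries, both nonzero near [t] whatever the two
    types are. *)
Lemma nonvanishing_base p b : nonvanishing_at 1 p b (p 0%N).2.
Proof.
move=> g t rg gt.
have nz b' : punctured_near (fun s => log_kernel (w b') (sqd (p 0%N).2 (g s)) != 0) t.
  have [a [c [aa ac c0 E]]] := log_kernel_regular rg (w_adm b').
  apply: (@log_quadratic_neq0 _ a c (fun=> 1) (fun=> 0) 0 t (2 * (w b').1.1)) => //.
  - by rewrite muln_gt0 /=; case/andP: (w_adm b').
  - exact: analytic_cst.
  - exact: analytic_cst.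
  by rewrite -gt; apply: punctured_sub E => s ->; rewrite mul0r add0r addr0 mulr1.
apply: punctured_sub (punctured_and (nz b) (nz (p 0%N).1)) => s [h1 h2].
rewrite (expand_det_row _ ord0) !big_ord_recl big_ord0 addr0 !mxE /= sqd0.
rewrite log_kernel0 // mul0r add0r mulf_neq0 // /cofactor mulf_neq0 ?signr_eq0 //.
by rewrite [X in \det X]mx11_scalar det_scalar1 !mxE /= sqdC.
Qed.

End KernelMatrix.
End Kernel.

(** * Zero sets *)

Section Zeros.
Context {R : realType}.
Implicit Types (f : R -> R) (t : R) (c d : nat -> R).

Definition vanishes_near f t := exists2 e : R, 0 < e & forall x, `|x| < e -> f (t + x) = 0.

Lemma open_localP (P : R -> Prop) :
  (forall t, P t -> exists2 e : R, 0 < e & forall x, `|x| < e -> P (t + x)) ->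
  open [set t | P t].
Proof.
move=> H; rewrite openE => t /= /H[e e0 He]; exists e => //= s /=.
by rewrite distrC => /He; rewrite addrC subrK.
Qed.

Lemma punctured_neq0_open f : open [set t | punctured_near (fun s => f s != 0) t].
Proof.
apply: open_localP => t [e e0 He]; exists e => // x xe.
have [->|x0] := eqVneq x 0; first by rewrite addr0; exists e.
exists (Num.min `|x| (e - `|x|)).
  by rewrite lt_min normr_gt0 x0 subr_gt0.
move=> y y0; rewrite lt_min => /andP[yx ye]; rewrite -addrA; apply: He.
  by rewrite addrC addr_eq0; apply: contraTneq yx => ->; rewrite normrN ltxx.
by apply: le_lt_trans (ler_normD _ _) _; rewrite -ltrBrDl.
Qed.

Lemma vanishes_near_open f : open [set t | vanishes_near f t].
Proof.
apply: open_localP => t [e e0 He]; exists e => // x xe.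
exists (e - `|x|); first by rewrite subr_gt0.
move=> y ye; rewrite -addrA; apply: He.
by apply: le_lt_trans (ler_normD _ _) _; rewrite -ltrBrDl.
Qed.

Lemma vanishes_punctured f t : vanishes_near f t -> ~ punctured_near (fun s => f s != 0) t.
Proof.
move=> [e e0 He] [e' e'0 He'].
have m0 : 0 < Num.min e e' by rewrite lt_min e0.
have x0 : 0 < Num.min e e' / 2 by rewrite divr_gt0.
have := He' _ (lt0r_neq0 x0); rewrite He ?eqxx ?(gtr0_norm x0).
  have : Num.min e e' <= e' by rewrite ge_min lexx orbT.
  by move=> h /(_ _)/negP; apply; [lra | ].
have : Num.min e e' <= e by rewrite ge_min lexx.
by move=> h; lra.
Qed.

(** The two alternatives are open and exclude each other, so by connectedness one of them holds on
    the whole segment. By compactness finitely many balls then cover it, each with no zero except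
    possibly its centre. Assuming the dichotomy instead of analyticity admits the logarithmic
    singularities at the nodes. *)
Lemma countable_zeros_itv f (a b : R) :
  (forall t, a <= t <= b -> vanishes_near f t \/ punctured_near (fun s => f s != 0) t) ->
  (exists2 t, a <= t <= b & punctured_near (fun s => f s != 0) t) ->
  countable [set t | a <= t <= b /\ f t = 0].
Proof.
move=> dich [t0 t0ab pt0].
have all_p t : a <= t <= b -> punctured_near (fun s => f s != 0) t.
  pose B := `[a, b]%classic `&` [set t | punctured_near (fun s => f s != 0) t].
  have BE : B = `[a, b]%classic.
    apply: (@segment_connected R a b).
    - by exists t0; split => //=; rewrite in_itv.
    - by exists [set t | punctured_near (fun s => f s != 0) t] => //; exact: punctured_neq0_open.
    exists (~` [set t | vanishes_near f t]); first exact/open_closedC/vanishes_near_open.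
    apply/seteqP; split => s /= [sab ps]; split => //.
      by move=> vs; exact: vanishes_punctured vs ps.
    by case: (dich s) => //; rewrite in_itv in sab.
  move=> tab; have : B t by rewrite BE /= in_itv.
  by case.
have eP (t : R) : exists e : R, 0 < e /\ (a <= t <= b ->
     forall x, x != 0 -> `|x| < e -> f (t + x) != 0).
  have [/all_p[e e0 H]|] := boolP (a <= t <= b); first by exists e.
  by exists 1.
have [e He] := choice eP.
have := @segment_compact R a b; rewrite compact_cover.
move=> /(_ _ [set t : R | a <= t <= b] (fun t => ball t (e t))) [].
- by move=> t _; exact: ball_open.
- by move=> t /=; rewrite in_itv /= => tab; exists t => //; apply: ballxx; have [] := He t.
move=> D DS cov; apply: (@sub_countable _ _ _ [set` D]); last first.
  by apply: finite_set_countable; exact: finite_fset.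
apply: subset_card_le => t /= [tab ft0].
have [|s sD] := cov t; first by rewrite /= in_itv.
rewrite /ball /= => st.
have sab : a <= s <= b by have := DS s sD; rewrite inE.
have [->//|ts] := eqVneq t s.
have := (He s).2 sab (t - s); rewrite subr_eq0 distrC => /(_ ts st).
by rewrite addrC subrK ft0 eqxx.
Qed.

Lemma countable_zeros_analytic f : (forall t, analytic f t) -> (exists t, f t != 0) ->
  countable [set t | f t = 0].
Proof.
move=> af [t0 ft0].
have -> : [set t | f t = 0] = \bigcup_(n in [set: nat])
    [set t | t0 - n%:R <= t <= t0 + n%:R /\ f t = 0].
  apply/seteqP; split => [t /= ft|t [n _ []]//].
  pose n := Num.truncn `|t - t0|.
  have : `|t - t0| < n.+1%:R by rewrite truncnS_gt.
  rewrite ltr_norml => /andP[h1 h2]; exists n.+1 => //=; split => //.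
  apply/andP; split; lra.
apply: bigcup_countable => // n _; apply: countable_zeros_itv.
  by move=> t _; exact: analytic_dichotomy.
exists t0; first by rewrite gerBl lerDl ler0n.
have [e e0 H] := analytic_neq0 (af t0) ft0.
by exists e => // x _; exact: H.
Qed.

Lemma punctured_notin (s : seq R) t : punctured_near (fun x => x \notin s) t.
Proof.
elim: s => [|y s IH]; first by exists 1.
suff h : punctured_near (fun x => x != y) t.
  apply: punctured_sub (punctured_and h IH) => x [xy xs].
  by rewrite inE negb_or xy.
have [->|ty] := eqVneq y t.
  by exists 1 => // x x0 _; rewrite addrC -subr_eq0 addrK.
exists `|y - t|; first by rewrite normr_gt0 subr_eq0.
move=> x _ h; apply: contraTneq h => <-; by rewrite addrC addKr ltxx.
Qed.

Lemma punctured_ex (P : R -> Prop) t : punctured_near P t -> exists x, P x.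
Proof.
move=> [e e0 H]; exists (t + e / 2); apply: H; first by rewrite lt0r_neq0 // divr_gt0.
rewrite gtr0_norm; lra.
Qed.

(** Convergence at the single point [e / 2] bounds the terms of the series there, hence the
    coefficients geometrically with rate [2 / e], and each coordinate acquires a jet. If both
    coefficients of index 1 vanished, the difference quotients would tend to 0, against
    regularity. *)
Lemma regular_curve (a b : R) (g : R -> R * R) : closed_regular_analytic_curve a b g ->
  forall t, a <= t <= b -> regular_at g t.
Proof.
move=> [ab ana _ dg] t tab; have ti : t \in `[a, b] by rewrite in_itv.
have [c] := ana t ti; have {ana} := dg t ti => dg0.
move=> /nbhs_ballP[e /= e0 He].
have key (pr : R * R -> R) : (forall x y, pr (x + y) = pr x + pr y) ->
    (forall (a : R) x, pr (a *: x) = a * pr x) -> continuous pr ->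
    jet (pr \o g) t (fun k => pr (c k)).
  move=> prD prZ prc.
  have pr0 : pr 0 = 0 by have := prZ 0 0; rewrite scale0r mul0r.
  have cv x : `|x| < e -> pseries (fun k => pr (c k)) x @ \oo --> pr (g (t + x)).
    move=> xe; have /= := He (t + x).
    rewrite /ball /= opprD addNKr normrN => /(_ xe) => h.
    have := cvg_comp _ _ h (prc (g (t + x))).
    rewrite (_ : pr \o _ = pseries (fun k => pr (c k)) x) //.
    apply/funext => n; rewrite /pseries /series /=.
    elim: n => [|n IH]; first by rewrite !big_geq.
    by rewrite !big_nat_recr //= prD IH prZ (addrC t) addrK mulrC.
  have x0 : 0 < e / 2 by rewrite divr_gt0.
  have e2e : `|e / 2| < e by rewrite gtr0_norm //; lra.
  have := cvg_series_cvg_0 (cvgP _ (cv _ e2e)).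
  move=> /cvgP /cvg_seq_bounded [M [Mr HM]].
  pose C := `|M| + 1.
  have C0 : 0 < C by rewrite ltr_wpDl.
  have cb n : `|pr (c n)| <= C * (e / 2)^-1 ^+ n.
    rewrite exprVn ler_pdivlMr ?exprn_gt0 //.
    have /= := HM C _ n I; rewrite normrM normrX (gtr0_norm x0); apply.
    by rewrite /C; apply: le_lt_trans (ler_norm _) _; rewrite ltrDl.
  have i0 : 0 < (e / 2)^-1 by rewrite invr_gt0.
  apply: (@jet_near _ (fun s => limn (pseries (fun k => pr (c k)) (s - t))) _ _ _ e e0).
    by move=> x xe; rewrite (addrC t) addrK; apply/cvg_lim => //; rewrite addrC; exact: cv.
  exact: jet_pseries C0 i0 cb.
have c1 : continuous (fst : R * R -> R) by case=> x y; exact: cvg_fst.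
have c2 : continuous (snd : R * R -> R) by case=> x y; exact: cvg_snd.
have j1 := key fst (fun _ _ => erefl) (fun _ _ => erefl) c1.
have j2 := key snd (fun _ _ => erefl) (fun _ _ => erefl) c2.
exists (fun k => (c k).1), (fun k => (c k).2); split => //.
have lim1 (f : R -> R) d : jet f t d -> h^-1 *: (f (h + t) - f t) @[h --> 0^'] --> d 1%N.
  move=> jf; have [C [M [r [C0 M0 r0 H K]]]] := jf.
  apply/cvgrPdist_le => eps eps0; rewrite near_withinE.
  exists (Num.min r (eps / (C * M ^+ 2))) => /=.
    by rewrite lt_min r0 divr_gt0 // mulr_gt0 // exprn_gt0.
  move=> x; rewrite /= sub0r normrN lt_min => /andP[xr].
  rewrite ltr_pdivlMr ?mulr_gt0 ?exprn_gt0 // => xe x0.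
  have := H 2%N x xr.
  rewrite !taylorS taylor0 add0r expr0 mulr1 expr1 -(jet_val jf) (addrC x) => h.
  have nx0 : 0 < `|x| by rewrite normr_gt0.
  rewrite distrC -(ler_pM2r nx0) -normrM mulrBl mulrAC mulVf // mul1r -addrA -opprD.
  apply: le_trans h _; rewrite exprMn.
  rewrite (_ : C * (M ^+ 2 * `|x| ^+ 2) = `|x| * (C * M ^+ 2) * `|x|); last by ring.
  by rewrite ler_pM2r // ltW.
rewrite -negb_and; apply: contra dg0 => /andP[/eqP d1 /eqP d2].
apply/eqP; rewrite /derive1; apply/cvg_lim => //.
have := cvg_pair (lim1 _ _ j1) (lim1 _ _ j2); rewrite /= d1 d2 => /(_ _ _ _).
by apply: cvg_trans; apply: near_eq_cvg; apply: nearW.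
Qed.

Section KernelZeros.
Variable w : bool -> nat * R * R.

Lemma analytic_det_kernel N p b (g : R -> R * R) t :
  analytic (fst \o g) t -> analytic (snd \o g) t -> (forall i, (i < N)%N -> g t != (p i).2) ->
  analytic (fun s => \det (kernel_mx w N.+1 (pcons (b, g s) p))) t.
Proof.
move=> a1 a2 gp; apply: analytic_det => i j.
case: i j => [[|i] Hi] [[|j] Hj].
- by under eq_fun do rewrite mxE /= sqd0; exact: analytic_cst.
- under eq_fun do rewrite mxE /=.
  apply: analytic_log_kernel; first exact: analytic_sqd.
  by rewrite sqd_gt0 eq_sym gp.
- under eq_fun do rewrite mxE /= sqdC.
  apply: analytic_log_kernel; first exact: analytic_sqd.
  by rewrite sqd_gt0 eq_sym gp.
- by under eq_fun do rewrite mxE /=; exact: analytic_cst.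
Qed.

(** Away from the nodes the determinant is analytic along the curve; at a node [nonvanishing_at]
    replaces the dichotomy. A node on the curve also excludes identical vanishing. *)
Lemma countable_zeros_curve N p b (a c : R) (g : R -> R * R) :
  (forall t, a <= t <= c -> regular_at g t) ->
  (forall i, (i < N)%N -> (exists2 t, a <= t <= c & g t = (p i).2) ->
     nonvanishing_at w N p b (p i).2) ->
  (exists2 i, (i < N)%N & exists2 t, a <= t <= c & g t = (p i).2) ->
  countable [set t | a <= t <= c /\ \det (kernel_mx w N.+1 (pcons (b, g t) p)) = 0].
Proof.
move=> rg nv [i0 i0N [t0 t0ac gt0]]; apply: countable_zeros_itv; last first.
  exists t0 => //.
  exact: (nv i0 i0N (ex_intro2 _ _ t0 t0ac gt0) g t0 (rg _ t0ac) gt0).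
move=> t tac; have [a1 a2] := regular_analytic (rg t tac).
have [/existsP[i /eqP gti]|/existsPn ngt] := boolP [exists i : 'I_N, g t == (p i).2].
  right; exact: (nv i (ltn_ord i) (ex_intro2 _ _ t tac gti) g t (rg _ tac) gti).
apply: analytic_dichotomy; apply: analytic_det_kernel => // i iN.
exact: (ngt (Ordinal iN)).
Qed.

End KernelZeros.
End Zeros.

(** * Null sets in the plane *)

Lemma product_measure1_null d1 d2 (T1 : measurableType d1) (T2 : measurableType d2)
    (R : realType) (m1 : {measure set T1 -> \bar R})
    (m2 : {sigma_finite_measure set T2 -> \bar R}) (A : set (T1 * T2)) :
  measurable A -> (\forall x \ae m1, m2 (xsection A x) = 0%E) -> (m1 \x m2)%E A = 0%E.
Proof.
move=> mA A0; rewrite /product_measure1.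
rewrite (@ae_eq_integral _ _ _ m1 setT (cst 0%E)) ?integral0 //.
- exact: measurable_fun_xsection.
- by apply: filterS A0 => x /= ->.
Qed.

Section Null.
Context {R : realType}.

Lemma leb2_null (A : set (R * R)) (X : set R) : measurable A -> countable X ->
  (forall x, ~ X x -> countable [set y | A (x, y)]) -> leb2 A = 0%E.
Proof.
move=> mA cX H; apply: product_measure1_null => //.
exists X; split.
- exact: countable_measurable.
- exact: countable_lebesgue_measure0.
move=> x /=; apply: contra_notP => nX; apply: countable_lebesgue_measure0.
by rewrite /xsection; under eq_set do rewrite in_setE; exact: H.
Qed.

Section KernelNull.
Variable w : bool -> nat * R * R.

Lemma measurable_sqd d (T : measurableType d) (A Q : T -> R * R) :
  measurable_fun setT A -> measurable_fun setT Q ->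
  measurable_fun setT (fun x => sqd (A x) (Q x)).
Proof.
move=> mA mQ; apply: measurable_funD; apply: measurable_funX; apply: measurable_funB;
 by apply: measurableT_comp.
Qed.

Lemma measurable_log_kernel d (T : measurableType d) k (f : T -> R) :
  measurable_fun setT f -> measurable_fun setT (fun x => log_kernel k (f x)).
Proof.
move=> mf; apply: measurable_funM; first exact: measurable_funX.
apply: measurable_funD => //; apply: measurable_funM => //.
by apply: measurableT_comp => //; exact: measurable_ln.
Qed.

Lemma measurable_det_kernel d (T : measurableType d) N
    (p : T -> nat -> bool * (R * R)) (b : nat -> bool) :
  (forall x i, (i < N)%N -> (p x i).1 = b i) ->
  (forall i, (i < N)%N -> measurable_fun setT (fun x => (p x i).2)) ->
  measurable_fun setT (fun x => \det (kernel_mx w N (p x))).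
Proof.
move=> pb mp; rewrite /determinant.
apply: measurable_sum => s; apply: measurable_funM => //.
apply: measurable_prod => i _.
under eq_fun do rewrite mxE pb //.
by apply: measurable_log_kernel; apply: measurable_sqd; exact: mp.
Qed.

(** On the vertical line through the node [i0] a height [ys] is found where the determinant is
    nonzero and which is the ordinate of no node. The horizontal line at [ys] then avoids all nodes,
    so its zeros are countable. Any vertical line through another of its points that also avoids the
    nodes has a nonzero value at [ys], hence countably many zeros. *)
Lemma kernel_zeros_null N p b :
  (exists2 i, (i < N)%N & nonvanishing_at w N p b (p i).2) ->
  leb2 [set z | \det (kernel_mx w N.+1 (pcons (b, z) p)) = 0] = 0%E.
Proof.
move=> [i0 i0N nv].
pose f z := \det (kernel_mx w N.+1 (pcons (b, z) p)).
pose X := [seq (p i).2.1 | i <- iota 0 N]; pose Y := [seq (p i).2.2 | i <- iota 0 N].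
have pX i : (i < N)%N -> (p i).2.1 \in X by move=> iN; apply: map_f; rewrite mem_iota.
have pY i : (i < N)%N -> (p i).2.2 \in Y by move=> iN; apply: map_f; rewrite mem_iota.
have ac (c t : R) : analytic (fun=> c) t := analytic_cst c t.
have av (t : R) : analytic id t.
  apply: (@analytic_near _ (fun s => (s - t) + t) id t 1) => // [x _|]; first by rewrite subrK.
  by apply: analyticD => //; eexists; exact: jet_var.
have vert x : x \notin X -> forall y, analytic (fun s => f (x, s)) y.
  move=> xX y; apply: (@analytic_det_kernel _ w N p b (fun s => (x, s))); [exact: ac | exact: av |].
  move=> i /pX iX /=.
  by apply: contraNneq xX => h; move: iX; rewrite -h.
have horz y : y \notin Y -> forall x, analytic (fun s => f (s, y)) x.
  move=> yY x; apply: (@analytic_det_kernel _ w N p b (fun s => (s, y))); [exact: av | exact: ac |].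
  move=> i /pY iY /=.
  by apply: contraNneq yY => h; move: iY; rewrite -h.
have [ys [ysY fys]] : exists y, y \notin Y /\ f ((p i0).2.1, y) != 0.
  pose g (s : R) := ((p i0).2.1, s).
  have rg : regular_at g (p i0).2.2.
    exists (fun i => if i == 0%N then (p i0).2.1 else 0).
    exists (fun i => (if i == 1%N then 1 else 0) + (if i == 0%N then (p i0).2.2 else 0)).
    split => /=; [exact: jet_cst| |by rewrite addr0 oner_eq0 orbT].
    apply: jet_near (jetD (jet_var _) (jet_cst (p i0).2.2 _)); first exact: ltr01.
    by move=> x _; rewrite subrK.
  have gt : g (p i0).2.2 = (p i0).2 by rewrite /g; case: (p i0).2.
  exact: punctured_ex (punctured_and (punctured_notin Y _) (nv g _ rg gt)).
pose X0 := [set x | f (x, ys) = 0] `|` [set` X].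
apply: (@leb2_null _ X0).
- rewrite -[X in measurable X]setTI.
  have : measurable_fun setT f.
    apply: (@measurable_det_kernel _ _ N.+1 _ (fun i => if i is j.+1 then (p j).1 else b)).
      by move=> z [].
    by move=> [|i] _ //=; exact: measurable_cst.
  by move=> /(_ measurableT [set 0] (measurable_set1 _)).
- rewrite /X0 -bigcup2E; apply: bigcup_countable => // -[|[|n]] _ /=.
  + apply: countable_zeros_analytic; first exact: horz.
    by exists (p i0).2.1.
  + by apply: finite_set_countable; exact: finite_seq.
  + exact: countable0.
move=> x /not_orP[/= /eqP fx /negP xX].
by apply: countable_zeros_analytic; [exact: vert | exists ys].
Qed.

End KernelNull.
End Null.

(** * The Laplacian of a thin-plate spline *)

Section Laplacian.
Context {R : realType}.

(** The family of kernels is closed under differentiation, which lowers the exponent by one. *)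
Lemma is_derive_log_kernel k (al be z : R) : 0 < z ->
  is_derive z (1 : R) (log_kernel (k.+1, al, be))
    (log_kernel (k, k.+1%:R * al, k.+1%:R * be + al) z).
Proof.
move=> z0; have dl := is_derive1_ln z0.
rewrite (_ : log_kernel _ = (id ^+ k.+1 : R -> R) * (al *: (@ln R) + cst be)); last first.
  by apply/funext => y; rewrite !fctE.
apply: is_derive_eq; rewrite /log_kernel /= !fctE /GRing.scale /= exprS.
by field; exact: lt0r_neq0.
Qed.

(** At the centre of a kernel the chain rule through [ln] fails, so derivatives there are taken from
    difference quotients; this bound sends those to 0. *)
Lemma log_kernel_small k (al be : R) : exists2 C : R, 0 < C &
  forall h : R, `|h| <= 1 -> `|log_kernel (k.+1, al, be) (h ^+ 2)| <= C * Num.sqrt `|h|.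
Proof.
exists (4 * `|al| + `|be| + 1).
  by rewrite ltr_wpDl // addr_ge0 // mulr_ge0.
move=> h h1; have [->|h0] := eqVneq h 0.
  by rewrite normr0 sqrtr0 mulr0 /log_kernel /= !expr0n /= mul0r normr0.
pose s := Num.sqrt `|h|.
have s0 : 0 < s by rewrite sqrtr_gt0 normr_gt0.
have s2 : s ^+ 2 = `|h| by rewrite sqr_sqrtr.
have s4 : h ^+ 2 = s ^+ 4 by rewrite -real_normK ?num_real // -s2 -exprM.
have s1 : s <= 1.
  by rewrite -(ler_pXn2r (n := 2)) ?nnegrE ?(ltW s0) // s2 expr1n.
have h4 := ln_root4_bound s0 s1.
have w40 : 0 <= s ^+ 4 by rewrite exprn_ge0 // ltW.
have sn n : s ^+ n <= 1 by rewrite exprn_ile1 // ltW.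
rewrite s4 /log_kernel /= normrM (ger0_norm (exprn_ge0 _ (exprn_ge0 _ (ltW s0)))).
apply: (@le_trans _ _ (s ^+ 4 * (`|al| * `|ln (s ^+ 4)| + `|be|))).
  rewrite exprS; apply: ler_pM => //.
  - by rewrite mulr_ge0 // exprn_ge0.
  - rewrite -[leRHS]mulr1; apply: ler_wpM2l => //.
    by rewrite -exprM sn.
  - by apply: le_trans (ler_normD _ _) _; rewrite normrM.
have -> : s ^+ 4 * (`|al| * `|ln (s ^+ 4)| + `|be|) =
    (s ^+ 2 * (s * `|ln (s ^+ 4)|) * `|al| + s ^+ 3 * `|be|) * s.
  rewrite [X in X * (_ + _)](_ : _ = s ^+ 3 * s); last by rewrite -exprSr.
  ring.
apply: ler_wpM2r; first exact: ltW.
have a1 : s ^+ 2 * (s * `|ln (s ^+ 4)|) * `|al| <= 4 * `|al|.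
  apply: ler_wpM2r => //; rewrite -[leRHS]mul1r; apply: ler_pM => //.
    by rewrite exprn_ge0 // ltW.
  by rewrite mulr_ge0 // ltW.
have a2 : s ^+ 3 * `|be| <= `|be| by rewrite ler_piMl.
lra.
Qed.

Lemma is_derive0_mul (g : R -> R) (C : R) : 0 < C ->
  (forall h : R, `|h| <= 1 -> `|g h| <= C * Num.sqrt `|h|) ->
  is_derive (0 : R) (1 : R) (fun h => h * g h) 0.
Proof.
move=> C0 H.
have L : h^-1 *: (((fun h => h * g h) \o shift 0) (h *: (1 : R)) - 0 * g 0)
    @[h --> 0^'] --> (0 : R).
  apply/cvgrPdist_le => eps eps0; rewrite near_withinE.
  exists (Num.min 1 ((eps / C) ^+ 2)) => /=.
    by rewrite lt_min ltr01 exprn_gt0 // divr_gt0.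
  move=> h; rewrite /= sub0r normrN lt_min => /andP[h1 hC] h0.
  rewrite mul0r subr0 addr0 /GRing.scale /= mulr1 mulKf // sub0r normrN.
  apply: le_trans (H h (ltW h1)) _; rewrite mulrC -ler_pdivlMr //.
  rewrite -(ler_pXn2r (n := 2)) ?nnegrE ?sqrtr_ge0 //.
    by rewrite sqr_sqrtr // ltW.
  by rewrite divr_ge0 // ltW.
apply: DeriveDef; first exact: cvgP L.
exact: cvg_lim L.
Qed.

Lemma is_derive_radial k (al be u c : R) : 0 <= c ->
  is_derive (0 : R) (1 : R) (fun h => log_kernel (k.+2, al, be) ((h + u) ^+ 2 + c))
    (2 * u * log_kernel (k.+1, k.+2%:R * al, k.+2%:R * be + al) (u ^+ 2 + c)).
Proof.
move=> c0; have : 0 <= u ^+ 2 + c by rewrite addr_ge0 // sqr_ge0.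
rewrite le_eqVlt => /orP[|z0].
  rewrite eq_sym paddr_eq0 ?sqr_ge0 // sqrf_eq0 => /andP[/eqP -> /eqP ->].
  rewrite mulr0 mul0r.
  have [C C0 H] := log_kernel_small k al be.
  rewrite (_ : (fun h => _) = (fun h => h * (h * log_kernel (k.+1, al, be) (h ^+ 2)))).
    apply: is_derive0_mul C0 _ => h h1; rewrite normrM.
    apply: le_trans (H h h1); exact: ler_piMl.
  apply/funext => h; rewrite !addr0 /log_kernel /= exprS; ring.
have dz : is_derive (0 : R) (1 : R) (fun h : R => (h + u) ^+ 2 + c) (2 * u).
  rewrite (_ : (fun h => _) = (id + cst u) ^+ 2 + cst c :> (R -> R)); last first.
    by apply/funext => y; rewrite !fctE.
  by apply: is_derive_eq; rewrite !fctE /GRing.scale /=; ring.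
have := is_derive_log_kernel k.+1 al be z0.
rewrite -[X in is_derive (X ^+ 2 + c)]add0r => dk.
rewrite mulrC -[in X in is_derive _ _ _ X](add0r u).
have := @is_derive1_comp _ (log_kernel (k.+2, al, be)) (fun h : R => (h + u) ^+ 2 + c) 0 _ _ dk dz.
by rewrite add0r.
Qed.

Lemma is_derive_radial2 k (al be u c : R) : 0 <= c ->
  is_derive (0 : R) (1 : R)
    (fun h => 2 * (h + u) * log_kernel (k.+1, al, be) ((h + u) ^+ 2 + c))
    (2 * log_kernel (k.+1, al, be) (u ^+ 2 + c) +
     4 * u ^+ 2 * log_kernel (k, k.+1%:R * al, k.+1%:R * be + al) (u ^+ 2 + c)).
Proof.
move=> c0; have : 0 <= u ^+ 2 + c by rewrite addr_ge0 // sqr_ge0.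
rewrite le_eqVlt => /orP[|z0].
  rewrite eq_sym paddr_eq0 ?sqr_ge0 // sqrf_eq0 => /andP[/eqP -> /eqP ->].
  have [C C0 H] := log_kernel_small k al be.
  rewrite (_ : (fun h => _) = (fun h => h * (2 * log_kernel (k.+1, al, be) (h ^+ 2)))); last first.
    by apply/funext => h; rewrite !addr0; ring.
  (* For [k = 0], which occurs when [nu = 2], the last kernel need not vanish at 0, but its factor
     [u ^+ 2] does. *)
  rewrite expr0n /= addr0 mulr0 mul0r addr0.
  rewrite {2}/log_kernel /= expr0n /= mul0r mulr0.
  apply: (@is_derive0_mul _ (2 * C)); first by rewrite mulr_gt0.
  by move=> h h1; rewrite normrM ger0_norm // -mulrA ler_pM2l //; exact: H.
have dz : is_derive (0 : R) (1 : R) (fun h : R => (h + u) ^+ 2 + c) (2 * u).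
  rewrite (_ : (fun h => _) = (id + cst u) ^+ 2 + cst c :> (R -> R)); last first.
    by apply/funext => y; rewrite !fctE.
  by apply: is_derive_eq; rewrite !fctE /GRing.scale /=; ring.
have := is_derive_log_kernel k al be z0.
rewrite -[X in is_derive (X ^+ 2 + c)]add0r => dk.
have dc := @is_derive1_comp _ (log_kernel (k.+1, al, be))
  (fun h : R => (h + u) ^+ 2 + c) 0 _ _ dk dz.
have -> : (fun h => 2 * (h + u) * log_kernel (k.+1, al, be) ((h + u) ^+ 2 + c)) =
  (2 *: (id + cst u)) * (log_kernel (k.+1, al, be) \o (fun h : R => (h + u) ^+ 2 + c)) :> (R -> R).
  by apply/funext => h; rewrite !fctE.
apply: is_derive_eq; rewrite !fctE /GRing.scale /= !add0r; ring.
Qed.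

Lemma derive_line (f : R * R -> R) (v Q : R * R) (d : R) :
  is_derive (0 : R) (1 : R) (fun h => f (h *: v + Q)) d -> 'D_v f Q = d.
Proof.
move=> [H <-]; rewrite /derive.
rewrite (_ : (fun h => h^-1 *: ((f \o shift Q) (h *: v) - f Q)) =
  (fun h => h^-1 *: (((fun h => f (h *: v + Q)) \o shift 0) (h *: (1 : R)) -
     f (0 *: v + Q)))) //.
apply/funext => h /=.
by rewrite scale0r add0r addr0 [X in _ = _ *: (f (X *: _ + _) - _)]mulr1.
Qed.

Section TPS.
Variable nu : nat.
Hypothesis nu2 : (2 <= nu)%N.

Lemma tps_atE (A Q : R * R) :
  tps_at nu A Q = log_kernel (nu, 2^-1, 0) (sqd A Q).
Proof.
rewrite /tps_at /tps /norm2 /log_kernel /= -/(sqd A Q).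
have := sqd_ge0 A Q; rewrite le_eqVlt => /orP[/eqP <-|z0].
  by rewrite sqrtr0 !expr0n double_eq0 gtn_eqF ?mul0r // ltnW.
rewrite -mul2n exprM sqr_sqrtr ?(ltW z0) // addr0; congr (_ * _).
rewrite -[in RHS](sqr_sqrtr (ltW z0)) lnXn ?sqrtr_gt0 //.
by field.
Qed.

(** With [z = r ^ 2] this is [4 nu r ^ (2 (nu - 1)) (nu ln r + 1)]; it also holds at the centre,
    where both sides are 0. *)
Lemma laplacian_tps (A Q : R * R) : laplacian (tps_at nu A) Q =
  log_kernel (nu.-1, 2 * nu%:R ^+ 2, 4 * nu%:R) (sqd A Q).
Proof.
case: nu nu2 tps_atE => [|[|k]] // _ tE.
pose W : nat * R * R := (k.+1, k.+2%:R * 2^-1, 2^-1).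
have D1 (P : R * R) : 'D_(1, 0) (tps_at k.+2 A) P = 2 * (P.1 - A.1) * log_kernel W (sqd A P).
  apply: derive_line.
  have := @is_derive_radial k 2^-1 0 (P.1 - A.1) ((P.2 - A.2) ^+ 2) (sqr_ge0 _).
  rewrite mulr0 add0r; congr (is_derive _ _ _ _); apply/funext => h.
  by rewrite tE /sqd /GRing.scale /= /GRing.scale /= mulr1 mulr0 add0r addrA.
have D2 (P : R * R) : 'D_(0, 1) (tps_at k.+2 A) P = 2 * (P.2 - A.2) * log_kernel W (sqd A P).
  apply: derive_line.
  have := @is_derive_radial k 2^-1 0 (P.2 - A.2) ((P.1 - A.1) ^+ 2) (sqr_ge0 _).
  rewrite mulr0 add0r [X in log_kernel _ X]addrC; congr (is_derive _ _ _ _); apply/funext => h.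
  rewrite tE /sqd /GRing.scale /= /GRing.scale /=; congr log_kernel; ring.
pose F1 (P : R * R) := 2 * (P.1 - A.1) * log_kernel W (sqd A P).
pose F2 (P : R * R) := 2 * (P.2 - A.2) * log_kernel W (sqd A P).
have DD1 : 'D_(1, 0) (tps_at k.+2 A) = F1 by exact/funext.
have DD2 : 'D_(0, 1) (tps_at k.+2 A) = F2 by exact/funext.
rewrite /laplacian DD1 DD2.
pose L (c : R) (u : R) := 2 * log_kernel W (u ^+ 2 + c) +
  4 * u ^+ 2 * log_kernel (k, k.+1%:R * W.1.2, k.+1%:R * W.2 + W.1.2) (u ^+ 2 + c).
have E1E : 'D_(1, 0) F1 Q = L ((Q.2 - A.2) ^+ 2) (Q.1 - A.1).
  apply: derive_line.
  have := @is_derive_radial2 k (k.+2%:R * 2^-1) 2^-1 (Q.1 - A.1) ((Q.2 - A.2) ^+ 2) (sqr_ge0 _).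
  congr (is_derive _ _ _ _); apply/funext => h.
  by rewrite /F1 /sqd /GRing.scale /= /GRing.scale /= mulr1 mulr0 add0r !addrA.
have E2E : 'D_(0, 1) F2 Q = L ((Q.1 - A.1) ^+ 2) (Q.2 - A.2).
  apply: derive_line.
  have := @is_derive_radial2 k (k.+2%:R * 2^-1) 2^-1 (Q.2 - A.2) ((Q.1 - A.1) ^+ 2) (sqr_ge0 _).
  congr (is_derive _ _ _ _); apply/funext => h.
  rewrite /F2 /sqd /GRing.scale /= /GRing.scale /= -/W.
  congr (_ * log_kernel W _); ring.
rewrite E1E E2E /L (addrC ((Q.2 - A.2) ^+ 2)) -/(sqd A Q) /log_kernel /= exprS.
set l := ln _; set z := sqd A Q ^+ k.
by rewrite -!natr1 /sqd; field.
Qed.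

End TPS.
End Laplacian.

(** * Independence *)

Section Independence.
Context d (T : measurableType d) (R : realType) (P : probability T R).

(** Independence identifies the joint law with the product of the two laws, so the claim is Fubini
    for null sets. *)
Lemma indep_pair_null d1 d2 (T1 : measurableType d1) (T2 : measurableType d2)
    (X : {RV P >-> T1}) (Y : {RV P >-> T2}) (A : set (T1 * T2)) :
  (forall B C, measurable B -> measurable C ->
     P (X @^-1` B `&` Y @^-1` C) = (P (X @^-1` B) * P (Y @^-1` C))%E) ->
  measurable A ->
  (\forall x \ae P, distribution P Y (xsection A (X x)) = 0%E) ->
  P [set x | A (X x, Y x)] = 0%E.
Proof.
move=> indep mA A0.
have mXY : measurable_fun setT (fun x => (X x, Y x)) by exact/measurable_fun_pair.
pose XY : {RV P >-> (T1 * T2)%type} := mfun_Sub (mem_set mXY).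
have := @product_measure_unique _ _ _ _ _ (distribution P X) (distribution P Y)
  (distribution P XY) indep A mA.
move=> h; rewrite -[LHS]/(distribution P XY A) -h.
apply: product_measure1_null => //.
(* The almost sure statement is transferred from [P] to the law of [X], for which the exceptional
   set of values has to be measurable. *)
have mS : measurable [set x | distribution P Y (xsection A x) != 0%E].
  have := @measurable_fun_xsection _ _ _ _ _ (distribution P Y) A mA.
  move=> /(_ measurableT (~` [set 0%E]) (measurableC (emeasurable_set1 _))).
  rewrite setTI; congr measurable; apply/seteqP; split => x /=.
    by move/eqP.
  by move=> /eqP.
exists [set x | distribution P Y (xsection A x) != 0%E]; split => //; last first.
  by move=> x /= /eqP.
apply: (measure_negligible (mu := P)); first exact: measurable_funPTI.
by apply: negligibleS A0 => x /= /eqP.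
Qed.

(** Both sides are finite measures in [B]. They agree on rectangles, which generate the product
    sigma-algebra and are stable under intersection. *)
Lemma indep_tuple d' (T' : measurableType d') (I : eqType) (Z : I -> {RV P >-> T'})
    (k : I) (s : seq I) (i0 : I) :
  (forall (r : seq I) (B : I -> set T'), uniq r -> (forall i, measurable (B i)) ->
     P (\bigcap_(i in [set` r]) Z i @^-1` B i) = (\prod_(i <- r) P (Z i @^-1` B i))%E) ->
  uniq (k :: s) ->
  forall B C, measurable B -> measurable C ->
  P ((fun x => [tuple Z (nth i0 s i) x | i < size s]) @^-1` B `&` Z k @^-1` C) =
  (P ((fun x => [tuple Z (nth i0 s i) x | i < size s]) @^-1` B) * P (Z k @^-1` C))%E.
Proof.
move=> indep /[dup] uks /= /andP[ks us] B C mB mC.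
set Y := fun x : T => _.
have mY : measurable_fun setT Y.
  apply/measurable_fun_tnthP => i; rewrite /Y (_ : _ \o _ = Z (nth i0 s i)) //.
  by apply/funext => x /=; rewrite tnth_mktuple.
pose Yrv : {RV P >-> (size s).-tuple T'} := mfun_Sub (mem_set mY).
have mZC : measurable (Z k @^-1` C).
  exact: measurable_funPTI.
(* Sides are indexed by labels, as in [indep]; since [s] has no repetition, every choice of sides by
   position is of this form. *)
pose rect (F : I -> set T') := [set y : (size s).-tuple T' |
  forall i : 'I_(size s), F (nth i0 s i) (tnth y i)].
pose G := [set A | exists2 F : I -> set T', (forall i, measurable (F i)) & A = rect F].
have rectE F : Y @^-1` rect F = \bigcap_(i in [set` s]) Z i @^-1` F i.
  apply/seteqP; split => x /=.
    move=> H i /= /(nthP i0)[j js <-].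
    by have := H (Ordinal js); rewrite tnth_mktuple.
  by move=> H i; rewrite tnth_mktuple; apply: H => /=; exact: mem_nth.
have mG : measurable = <<s G>>.
  apply/seteqP; split; apply: smallest_sub.
  - exact: smallest_sigma_algebra.
  - rewrite -bigcup_seq => A [i _ [D mD <-]]; apply: sub_sigma_algebra.
    exists (fun j => if j == nth i0 s i then D else setT).
      by move=> j; case: ifP.
    rewrite setTI; apply/seteqP; split => y /=.
      move=> Dy j; case: ifPn => // /eqP /eqP; rewrite nth_uniq //.
      by move/eqP/val_inj => ->.
    by move=> /(_ i); rewrite eqxx.
  - exact: sigma_algebra_measurable.
  - move=> _ [F mF ->].
    rewrite (_ : rect F = \bigcap_(i in [set: 'I_(size s)])
       ((fun y => tnth y i) @^-1` F (nth i0 s i))).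
      apply: fin_bigcap_measurable => // i _; rewrite -[X in measurable X]setTI.
      exact: measurable_tnth.
    by apply/seteqP; split => y /= H i; [move=> _ | ]; apply: H.
pose m1 := mrestr P mZC.
pose r := fine (P (Z k @^-1` C)).
have r0 : 0 <= r by rewrite fine_ge0.
have rE : r%:E = P (Z k @^-1` C) by rewrite fineK // fin_num_measure.
have msE A : mscale (NngNum r0) (distribution P Yrv) A =
    (P (Z k @^-1` C) * P (Y @^-1` A))%E by rewrite -rE.
have eqm : forall A, measurable A -> pushforward m1 Yrv A =
    mscale (NngNum r0) (distribution P Yrv) A.
  apply: (@measure_unique _ _ _ G (fun=> setT) mG).
  - move=> _ _ [F mF ->] [F' mF' ->]; exists (fun i => F i `&` F' i).
      by move=> i; exact: measurableI.
    apply/seteqP; split => y /=; first by move=> [H1 H2] i; split.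
    by move=> H; split => i; have [] := H i.
  - by move=> _; exists (fun=> setT) => //; apply/seteqP; split.
  - by rewrite bigcup_const //; exists 0%N.
  - move=> _ [F mF ->]; apply: etrans (esym (msE (rect F))); rewrite /= /pushforward /m1 /mrestr.
    rewrite (_ : Yrv @^-1` rect F = Y @^-1` rect F) // rectE (indep s F us mF) muleC.
    pose F' i := if i == k then C else F i.
    have F'k : F' k = C by rewrite /F' eqxx.
    have FF' i : i \in s -> F' i = F i.
      by move=> ii; rewrite /F'; case: eqP => // ik; rewrite -ik ii in ks.
    have := indep (k :: s) F' uks; rewrite big_cons.
    rewrite F'k muleC (eq_big_seq (fun i => P (Z i @^-1` F i))); last first.
      by move=> i /FF' ->.
    move=> <-; last by move=> i; rewrite /F'; case: ifP.
    congr (P _); apply/seteqP; split => x /=.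
      move=> [H1 H2] i /=; rewrite inE => /orP[/eqP ->|ii]; first by rewrite /F' eqxx.
      by rewrite FF' //; exact: H1.
    move=> H; split; last by have := H k; rewrite /F' eqxx; apply; rewrite /= inE eqxx.
    by move=> i /= ii; rewrite -FF' //; apply: H; rewrite /= inE ii orbT.
  - move=> _; rewrite -[ltLHS]/(P (Y @^-1` setT `&` Z k @^-1` C)).
    by rewrite preimage_setT setTI ltey_eq fin_num_measure.
have := eqm B mB; rewrite msE /pushforward /m1 /mrestr => ->.
by rewrite muleC.
Qed.

End Independence.

(** * Adding random nodes one at a time *)

Section RandomKernel.
Context {R : realType}.
Variable w : bool -> nat * R * R.
Hypothesis w_adm : forall b, admissible (w b).

Lemma eq_kernel_mx N (p q : nat -> bool * (R * R)) :
  (forall i, (i < N)%N -> p i = q i) -> kernel_mx w N p = kernel_mx w N q.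
Proof. by move=> pq; apply/matrixP => i j; rewrite !mxE !pq. Qed.

Lemma det_kernel_perm (K : eqType) (z : K -> bool * (R * R)) (k0 : K) (s s' : seq K) :
  perm_eq s s' ->
  (\det (kernel_mx w (size s) (fun i => z (nth k0 s i))) != 0) =
  (\det (kernel_mx w (size s') (fun i => z (nth k0 s' i))) != 0).
Proof.
move=> ss'; rewrite (perm_size ss'); set N := size s'.
have [Is pI sE] := perm_iotaP k0 ss'.
have sI : size Is = N by rewrite (perm_size pI) size_iota.
have uI : uniq Is by rewrite (perm_uniq pI) iota_uniq.
have Ilt (i : 'I_N) : (nth 0%N Is i < N)%N.
  have : nth 0%N Is i \in iota 0 N by rewrite -(perm_mem pI) mem_nth // sI.
  by rewrite mem_iota.
pose f (i : 'I_N) := Ordinal (Ilt i).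
have fI : injective f.
  move=> i j [] /eqP; rewrite nth_uniq ?sI //; exact: (fun e => val_inj (eqP e)).
pose A := kernel_mx w N (fun i => z (nth k0 s' i)).
rewrite (_ : kernel_mx w N (fun i => z (nth k0 s i)) = row_perm (perm fI) (col_perm (perm fI) A)).
  rewrite row_permE col_permE !det_mulmx !det_perm mulf_eq0 negb_or signr_eq0 /=.
  by rewrite mulf_eq0 negb_or signr_eq0 andbT.
apply/matrixP => i j; rewrite !mxE !permE /= sE.
by rewrite !(nth_map 0%N) ?sI.
Qed.

Context d (T : measurableType d) (P : probability T R).
Variable Z : bool * nat -> {RV P >-> (R * R)%type}.
Variables (a c : R) (g : R -> R * R).
Hypothesis g_reg : forall t, a <= t <= c -> regular_at g t.
Hypothesis Z_indep : forall (r : seq (bool * nat)) (B : bool * nat -> set (R * R)),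
  uniq r -> (forall k, measurable (B k)) ->
  P (\bigcap_(k in [set` r]) Z k @^-1` B k) = (\prod_(k <- r) P (Z k @^-1` B k))%E.
Hypothesis Z_off : forall i, \forall x \ae P, forall t, a <= t <= c -> g t != Z (true, i) x.
Hypothesis Z_on : forall i, \forall x \ae P, exists2 t, a <= t <= c & g t = Z (false, i) x.
Hypothesis Z_null : forall i (B : set (R * R)), measurable B -> leb2 B = 0%E ->
  P (Z (true, i) @^-1` B) = 0%E.
Hypothesis Z_null_curve : forall i (B : set (R * R)), measurable B ->
  countable [set t | a <= t <= c /\ B (g t)] -> P (Z (false, i) @^-1` B) = 0%E.

Let k0 : bool * nat := (true, 0%N).

Definition points (s : seq (bool * nat)) (x : T) (i : nat) : bool * (R * R) :=
  let k := nth k0 s i in (k.1, Z k x).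

Definition almost_nonsingular (s : seq (bool * nat)) :=
  \forall x \ae P, \det (kernel_mx w (size s) (points s x)) != 0.

Lemma ae_seq (s : seq (bool * nat)) (Q : bool * nat -> T -> Prop) :
  (forall k, \forall x \ae P, Q k x) -> \forall x \ae P, forall k, k \in s -> Q k x.
Proof.
move=> H; elim: s => [|k s IH]; first exact: nearW.
move: (H k) IH; apply: filterS2 => x Qk IH j; rewrite inE => /orP[/eqP -> //|]; exact: IH.
Qed.

(** With the earlier nodes frozen, the bad positions of the node [k] form a null set for its law: a
    planar null set if it is interior, a countable set of abscissas if it is on the boundary.
    Independence then integrates over the earlier nodes. *)
Lemma almost_nonsingular_step k (s : seq (bool * nat)) : uniq (k :: s) ->
  (exists2 j, j \in s & ~~ k.1 -> ~~ j.1) ->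
  (\forall x \ae P, forall i, (i < size s)%N ->
     ((nth k0 s i).1 = k.1 \/ size s = 1%N) ->
     nonvanishing_at w (size s) (points s x) k.1 (points s x i).2) ->
  ((exists2 j, j \in s & j.1 = k.1) \/ size s = 1%N) ->
  almost_nonsingular (k :: s).
Proof.
move=> uks [j js kj] nv sk.
set N := size s.
pose q (y : N.-tuple (R * R)) (i : nat) := ((nth k0 s i).1, nth 0 y i).
pose A := [set u : N.-tuple (R * R) * (R * R) |
  \det (kernel_mx w N.+1 (pcons (k.1, u.2) (q u.1))) = 0].
have mA : measurable A.
  have : measurable_fun setT (fun u : N.-tuple (R * R) * (R * R) =>
      \det (kernel_mx w N.+1 (pcons (k.1, u.2) (q u.1)))).
    apply: (@measurable_det_kernel _ w _ _ N.+1 _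
      (fun i => if i is i'.+1 then (nth k0 s i').1 else k.1)).
      by move=> u [].
    move=> [|i] iN /=; first exact: measurable_snd.
    rewrite (_ : (fun x => _) = (fun u : N.-tuple (R * R) * (R * R) =>
        tnth u.1 (Ordinal (iN : (i < N)%N)))).
      by apply: (measurableT_comp (measurable_tnth _)).
    by apply/funext => u; rewrite (tnth_nth 0).
  by move=> /(_ measurableT [set 0] (measurable_set1 _)); rewrite setTI.
pose Yf x := [tuple Z (nth k0 s i) x | i < N].
have mY : measurable_fun setT Yf.
  apply/measurable_fun_tnthP => i; rewrite (_ : _ \o _ = Z (nth k0 s i)) //.
  by apply/funext => x /=; rewrite tnth_mktuple.
pose Y : {RV P >-> N.-tuple (R * R)} := mfun_Sub (mem_set mY).
have qY x i : (i < N)%N -> q (Y x) i = points s x i.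
  move=> iN; rewrite /q /points; congr (_, _).
  by rewrite -[i in LHS]/(val (Ordinal iN)) -tnth_nth tnth_mktuple.
have secE x : xsection A (Y x) =
    [set z | \det (kernel_mx w N.+1 (pcons (k.1, z) (points s x))) = 0].
  apply/seteqP; split => z; rewrite /xsection /= inE /A /=;
  by rewrite (@eq_kernel_mx _ _ (pcons (k.1, z) (points s x))) // => -[|i] //= /qY.
have msec x : measurable (xsection A (Y x)) by exact: measurable_xsection.
have null : \forall x \ae P, distribution P (Z k) (xsection A (Y x)) = 0%E.
  have on_off := @ae_seq s (fun k x => if k.1 then forall t, a <= t <= c -> g t != Z k x
      else exists2 t, a <= t <= c & g t = Z k x).
  have {}on_off : \forall x \ae P, forall k, k \in s ->
      if k.1 then forall t, a <= t <= c -> g t != Z k x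
      else exists2 t, a <= t <= c & g t = Z k x.
    by apply: on_off => -[[] i] /=; [exact: Z_off | exact: Z_on].
  move: on_off nv; apply: filterS2 => x on_off nv.
  have pE i : (points s x i).2 = Z (nth k0 s i) x by [].
  have idx i : i \in s -> exists2 l, (l < N)%N & nth k0 s l = i.
    by move=> /(nthP k0)[l ls <-]; exists l.
  case: k uks kj sk nv A mA secE msec => -[] k /= uks kj sk nv A mA secE msec.
    apply: Z_null => //; rewrite secE; apply: kernel_zeros_null.
    case: sk => [[i /idx[l lN li] i1]|s1].
      by exists l => //; apply: nv => //; left; rewrite li.
    by exists 0%N; [rewrite /N s1 | apply: nv; rewrite ?s1 //; right].
  apply: Z_null_curve => //; rewrite (_ : [set t | _] =
    [set t | a <= t <= c /\ \det (kernel_mx w N.+1 (pcons (false, g t) (points s x))) = 0]);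
    last first.
    by apply/seteqP; split => t /= [tac]; rewrite secE.
  apply: countable_zeros_curve => //.
    (* An earlier node met by the curve is a boundary node, as interior ones avoid the curve almost
       surely; so it has the type of the new node. *)
    move=> l lN [t tac gt]; apply: nv => //.
    have ls : nth k0 s l \in s by exact: mem_nth.
    have := on_off _ ls; case E : (nth k0 s l).1; last by left.
    by move=> /(_ t tac); rewrite gt pE eqxx.
  have [l lN lj] := idx j js; exists l => //.
  by have := on_off j js; rewrite pE lj (negbTE (kj isT)).
have := indep_pair_null (X := Y) (Y := Z k) (indep_tuple k0 Z_indep uks) mA null => h.
rewrite /almost_nonsingular; exists [set x | A (Y x, Z k x)]; split => //.
  rewrite -[X in measurable X]setTI.
  by apply: (measurable_fun_pair mY (measurable_funPT (Z k))) => //; exact: measurableT.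
move=> x /= /negP; rewrite negbK => /eqP h0; rewrite /A /= -[RHS]h0.
by congr (\det _); apply: eq_kernel_mx => -[|i] //= /qY.
Qed.

Lemma almost_nonsingular_add k s : uniq (k :: s) -> almost_nonsingular s ->
  (exists2 j, j \in s & j.1 = k.1) -> almost_nonsingular (k :: s).
Proof.
move=> uks ns [j js jk]; have jk' : ~~ k.1 -> ~~ j.1 by rewrite jk.
apply: almost_nonsingular_step => //; [by exists j | | by left; exists j].
apply: filterS ns => x dx i iN H.
have uK : kernel_mx w (size s) (points s x) \in unitmx by rewrite unitmxE unitfE.
case: H => [<-|s1]; first exact: (@nonvanishing_add _ _ w_adm _ _ (Ordinal iN)).
move: iN dx; rewrite s1; case: i => // _ _.
exact: (nonvanishing_base w_adm).
Qed.

(** The head of the list is added last. In a mixed pair the boundary node therefore comes first,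
    since a boundary node can only be added when another one already lies on the curve. *)
Lemma almost_nonsingular_pair k j : k != j -> (~~ k.1 -> ~~ j.1) ->
  almost_nonsingular [:: k; j].
Proof.
move=> kj kj1; have jj : j \in [:: j] by rewrite inE.
apply: almost_nonsingular_step => //; [by rewrite /= inE kj | by exists j | | by right].
apply: nearW => x -[|//] _ _; exact: (nonvanishing_base w_adm).
Qed.

Lemma almost_nonsingular_cat r s : uniq (r ++ s) -> almost_nonsingular s ->
  (forall k, k \in r -> exists2 j, j \in s & j.1 = k.1) -> almost_nonsingular (r ++ s).
Proof.
move=> + ns; elim: r => [|k r IH] //= /[dup] urs /andP[_ ur] H.
apply: almost_nonsingular_add => //.
  by apply: IH => // i ir; apply: H; rewrite inE ir orbT.
have [|j js jk] := H k; first by rewrite inE eqxx.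
by exists j; rewrite // mem_cat js orbT.
Qed.

Lemma almost_nonsingular_perm s s' : perm_eq s s' ->
  almost_nonsingular s' -> almost_nonsingular s.
Proof.
move=> ss'; apply: filterS => x.
by rewrite (det_kernel_perm (fun k => (k.1, Z k x)) k0 ss').
Qed.

(** The starting pair, moved to the end of the list, contains every type that occurs, so each later
    node finds one of its own type: two equal types if a block is empty, otherwise an interior node
    on top of a boundary node. *)
Lemma almost_nonsingular_block n m : (2 <= n + m)%N ->
  almost_nonsingular ([seq (true, i) | i <- iota 0 n] ++ [seq (false, i) | i <- iota 0 m]).
Proof.
move=> nm; have pI b : injective (pair b : nat -> bool * nat) by move=> i j [].
have us : uniq ([seq (true, i) | i <- iota 0 n] ++ [seq (false, i) | i <- iota 0 m]).
  rewrite cat_uniq !map_inj_uniq // !iota_uniq /= andbT; apply/hasPn => k /mapP[i _ ->].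
  by apply/negP => /mapP[].
suff [x [y [r [pr xy rxy]]]] : exists x y r, [/\
    perm_eq ([seq (true, i) | i <- iota 0 n] ++ [seq (false, i) | i <- iota 0 m]) (r ++ [:: x; y]),
    ~~ x.1 -> ~~ y.1 & forall k : bool * nat, k \in r -> exists2 j, j \in [:: x; y] & j.1 = k.1].
  apply: (almost_nonsingular_perm pr); rewrite (perm_uniq pr) in us.
  apply: almost_nonsingular_cat => //; apply: almost_nonsingular_pair => //.
  by move: us; rewrite cat_uniq /= inE => /and3P[_ _ /andP[]].
have rot2 b (p : seq nat) x y : perm_eq [seq (b, i) | i <- x :: y :: p]
    ([seq (b, i) | i <- p] ++ [:: (b, x); (b, y)]).
  by rewrite perm_sym perm_catC.
case: n m nm us => [|n] [|m] //= nm _.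
- case: m nm => // m _; exists (false, 0%N), (false, 1%N), [seq (false, i) | i <- iota 2 m].
  split => //; first exact: rot2.
  by move=> k /mapP[i _ ->]; exists (false, 0%N); rewrite ?inE ?eqxx.
- case: n nm => // n _; exists (true, 0%N), (true, 1%N), [seq (true, i) | i <- iota 2 n].
  split => //; first by rewrite cats0; exact: rot2.
  by move=> k /mapP[i _ ->]; exists (true, 0%N); rewrite ?inE ?eqxx.
exists (true, 0%N), (false, 0%N),
  ([seq (true, i) | i <- iota 1 n] ++ [seq (false, i) | i <- iota 1 m]).
split => //.
  apply/seq.permP => Q; rewrite /= !count_cat /=; lia.
move=> k; rewrite mem_cat => /orP[] /mapP[i _ ->].
  by exists (true, 0%N); rewrite ?inE ?eqxx.
by exists (false, 0%N); rewrite ?inE ?eqxx ?orbT.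
Qed.

End RandomKernel.

(** * The Kansa matrix *)

(** The measurable sets of [R * R] form the product sigma-algebra. An open set is the countable
    union of the boxes with rational centre and radius [1 / (k + 1)] that it contains. *)
Lemma open_measurable_prod (R : realType) (A : set (R * R)) : open A -> measurable A.
Proof.
move=> oA.
pose box (p q : rat) (k : nat) : set (R * R) :=
  ball (ratr p : R) (k.+1%:R^-1) `*` ball (ratr q : R) (k.+1%:R^-1).
have -> : A = \bigcup_p \bigcup_q \bigcup_k
    (if `[< box p q k `<=` A >] then box p q k else set0).
  apply/seteqP; split=> [[x y] Axy|x [p _ [q _ [k _]]]]; last first.
    by case: ifPn => // /asboolP; apply.
  have := oA; rewrite openE => /(_ _ Axy) /nbhs_ballP[e /= e0 eA].
  have e20 : 0 < e / 2 by rewrite divr_gt0.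
  pose k := Num.truncn (e / 2)^-1.
  have ke : k.+1%:R^-1 < e / 2.
    by rewrite invf_plt ?posrE // truncnS_gt.
  have k0 : 0 < k.+1%:R^-1 :> R by rewrite invr_gt0.
  have near_rat (z : R) : exists p : rat, `|z - ratr p| < k.+1%:R^-1.
    move: k.+1%:R^-1 k0 => r r0.
    have [|p] := @rat_in_itvoo R (z - r) (z + r); first lra.
    rewrite in_itv /= => /andP[h1 h2]; exists p; rewrite ltr_norml; apply/andP; split; lra.
  have [p xp] := near_rat x; have [q yq] := near_rat y.
  exists p => //; exists q => //; exists k => //; rewrite ifT.
    by split; rewrite /= /ball /= distrC.
  apply/asboolP => -[u v] [/= up vq]; apply: eA; split => /=; rewrite /ball /=.
    apply: le_lt_trans (ler_distD (ratr p) _ _) _.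
    by apply: lt_trans (ltrD xp up) _; rewrite [ltRHS]splitr ltrD.
  apply: le_lt_trans (ler_distD (ratr q) _ _) _.
  by apply: lt_trans (ltrD yq vq) _; rewrite [ltRHS]splitr ltrD.
apply: bigcupT_measurable_rat => p; apply: bigcupT_measurable_rat => q.
apply: bigcupT_measurable => k; case: ifP => // _.
by apply: measurableX; exact: measurable_ball.
Qed.

(** * Measurability of the boundary curve *)

Section CurvePatch.
Context {R : realType}.
Variables (a b : R) (g : R -> R * R).

(** Off [[a, b]] the curve may fail to be measurable. *)
Definition curve_patch (s : R) : R * R := if a <= s <= b then g s else 0.

Lemma measurable_curve_patch : (forall t, a <= t <= b -> regular_at g t) ->
  measurable_fun setT curve_patch.
Proof.
move=> rg.
have key (pr : R * R -> R) : (forall t, a <= t <= b -> analytic (pr \o g) t) -> pr 0 = 0 ->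
    measurable_fun setT (fun s => pr (curve_patch s)).
  move=> apr pr0.
  rewrite (_ : (fun s => _) = (pr \o g) \_ `[a, b]).
    apply: (measurable_restrictT (pr \o g) (measurable_itv `[a, b])).1.
    apply: subspace_continuous_measurable_fun => //.
    apply: continuous_in_subspaceT => t /set_mem; rewrite /= in_itv /= => tab.
    have [C [e [C0 e0 H]]] := analytic_lip (apr t tab).
    apply/cvgrPdist_le => eps eps0.
    exists (Num.min e (eps / C)) => /=; first by rewrite lt_min e0 divr_gt0.
    move=> s /=; rewrite distrC lt_min => /andP[se sC].
    have := H (s - t) se; rewrite (addrC t) subrK distrC => /le_trans; apply.
    by rewrite mulrC -ler_pdivlMr // ltW.
  apply/funext => s; rewrite patchE /curve_patch.
  have -> : (s \in `[a, b]%classic) = (a <= s <= b).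
    by apply/idP/idP => [/set_mem|sab]; [|apply/mem_set]; rewrite /= in_itv.
  by case: ifP.
have m1 := key fst (fun t tab => (regular_analytic (rg t tab)).1) erefl.
have m2 := key snd (fun t tab => (regular_analytic (rg t tab)).2) erefl.
rewrite (_ : curve_patch = fun s => ((curve_patch s).1, (curve_patch s).2)).
  exact: measurable_fun_pair.
by apply/funext => s; case: (curve_patch s).
Qed.
End CurvePatch.

(** * Joint independence of interior and boundary nodes *)

Section Combine.
Context {R : realType} d (T : measurableType d) (P : probability T R).

(** A finite intersection splits by type: independence of the two families separates the parts, and
    mutual independence factors each of them. *)
Lemma independent_merge d1 (T1 : measurableType d1) d2 (T2 : measurableType d2)
    (X : nat -> {RV P >-> T1}) (Y : nat -> {RV P >-> T2}) (h : T2 -> T1)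
    (Z : bool * nat -> T -> T1) :
  measurable_fun setT h ->
  (forall i, Z (true, i) = X i) -> (forall i, Z (false, i) = h \o Y i) ->
  independent_rvs P (fun i => X i : T -> T1) ->
  independent_rvs P (fun i => Y i : T -> T2) ->
  independent_families P (fun i => X i : T -> T1) (fun i => Y i : T -> T2) ->
  forall (r : seq (bool * nat)) (B : bool * nat -> set T1),
  uniq r -> (forall k, measurable (B k)) ->
  P (\bigcap_(k in [set` r]) Z k @^-1` B k) = (\prod_(k <- r) P (Z k @^-1` B k))%E.
Proof.
move=> mh ZX ZY iX iY iXY r B ur mB.
pose EX i := Z (true, i) @^-1` B (true, i); pose EY i := Z (false, i) @^-1` B (false, i).
have sX i : sigma_rv (X i) (EX i).
  by exists (B (true, i)) => //; rewrite setTI /EX ZX.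
have sY i : sigma_rv (Y i) (EY i).
  exists (h @^-1` B (false, i)); last by rewrite setTI /EY ZY.
  by rewrite -[X in measurable X]setTI; exact: mh.
pose J b := [fset i in [seq k.2 | k <- r & k.1 == b]]%fset.
have memJ b i : (i \in J b) = ((b, i) \in r).
  rewrite !inE; apply/mapP/idP => [[[b' i'] + ->]|bi].
    by rewrite mem_filter /= => /andP[/eqP <-].
  by exists (b, i); rewrite // mem_filter eqxx.
have -> : \bigcap_(k in [set` r]) Z k @^-1` B k =
    (\bigcap_(i in [set` J true]) EX i) `&` (\bigcap_(i in [set` J false]) EY i).
  apply/seteqP; split => x /=.
    by move=> H; split => i /=; rewrite memJ => ir; exact: (H _ ir).
  by move=> [H1 H2] [[] i] /= ir; [apply: H1 | apply: H2]; rewrite /= memJ.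
rewrite iXY; last 2 first.
- apply: (@fin_bigcap_measurable _ (g_sigma_algebraType _)) => // i _.
  by apply: sub_sigma_algebra; exists i.
- apply: (@fin_bigcap_measurable _ (g_sigma_algebraType _)) => // i _.
  by apply: sub_sigma_algebra; exists i.
rewrite (iX _ EX); last by move=> i _; exact: sX.
rewrite (iY _ EY); last by move=> i _; exact: sY.
have prodJ b : (\prod_(i <- J b) P (Z (b, i) @^-1` B (b, i)) =
    \prod_(k <- r | k.1 == b) P (Z k @^-1` B k))%E.
  transitivity (\prod_(i <- [seq k.2 | k <- r & k.1 == b]) P (Z (b, i) @^-1` B (b, i)))%E.
    apply: perm_big; apply: uniq_perm; first exact: fset_uniq.
      rewrite map_inj_in_uniq ?filter_uniq // => -[b1 i1] [b2 i2].
      by rewrite !mem_filter /= => /andP[/eqP -> _] /andP[/eqP -> _] ->.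
    by move=> i; rewrite !inE.
  rewrite big_map big_filter; apply: eq_bigr => -[b' i] /= /eqP ->.
  by [].
rewrite [RHS](bigID (fun k => k.1 == true)) /=; congr (_ * _)%E.
  exact: prodJ true.
rewrite -[LHS]/(\prod_(i <- J false) P (Z (false, i) @^-1` B (false, i)))%E (prodJ false).
by apply: eq_bigl => -[[] i].
Qed.

End Combine.

(** In terms of [z = r ^ 2]: [Delta phi] for interior points ([true]) and [phi] for
    boundary points ([false]). *)
Definition kansa_kernel (R : realType) (nu : nat) (b : bool) : nat * R * R :=
  if b then (nu.-1, 2 * nu%:R ^+ 2, 4 * nu%:R) else (nu, 2^-1, 0).

Lemma kansa_kernel_admissible (R : realType) nu b : (2 <= nu)%N ->
  admissible (@kansa_kernel R nu b).
Proof.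
by case: nu => [|[|nu]] // _; case: b; rewrite /admissible /= ?invr_eq0 ?pnatr_eq0.
Qed.

Lemma kansa_kernel_mx (R : realType) nu n m (p : 'I_n -> R * R) (q : 'I_m -> R * R)
    (z : nat -> bool * (R * R)) : (2 <= nu)%N ->
  (forall i : 'I_n, z i = (true, p i)) -> (forall i : 'I_m, z (n + i)%N = (false, q i)) ->
  kansa_mx nu p q = kernel_mx (kansa_kernel R nu) (n + m) z.
Proof.
move=> nu2 zp zq; apply/matrixP => i j; rewrite !mxE.
case: splitP => i' ->; rewrite !mxE; case: splitP => j' ->; rewrite !mxE;
  by rewrite ?zp ?zq /= ?laplacian_tps ?tps_atE.
Qed.

Lemma density_null (R : realType) d (T : measurableType d) (P : probability T R)
    (D : set R) (f : R -> R) (X : {RV P >-> R}) (A : set R) :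
  has_density D f X -> measurable D -> measurable A -> countable (A `&` D) -> P (X @^-1` A) = 0%E.
Proof.
move=> fX mD mA cA; rewrite -[LHS]/(distribution P X A) fX //.
apply: null_set_integral.
- exact: measurableI.
(* On a countable domain every function is measurable, so nothing has to be known about the
   density. *)
- move=> _ B _; apply: countable_measurable => //; apply: sub_countable cA.
  by apply: subset_card_le => x [].
- exact: countable_lebesgue_measure0.
Qed.

Theorem theorem1 (R : realType) (nu : nat) (Hnu : (2 <= nu)%N)
    (Omega : set (R * R)) (a b : R) (gamma : R -> R * R)
    (Omega_bounded : bounded_set Omega)
    (Omega_connected : connected Omega)
    (Omega_open : open Omega)
    (gamma_curve : closed_regular_analytic_curve a b gamma)
    (Omega_boundary : boundary Omega = gamma @` `[a, b])
    (d : measure_display) (T : measurableType d) (P : probability T R)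
    (X : nat -> {RV P >-> (R * R)%type}) (t : nat -> {RV P >-> R})
    (X_indep : independent_rvs P (fun i => X i : T -> R * R))
    (X_unif : forall i, uniform_on Omega (X i))
    (t_indep : independent_rvs P (fun h => t h : T -> R))
    (t_law : forall h, has_density `]a, b[
       (fun s => norm2 (derive1 gamma s) / curve_length a b gamma) (t h))
    (Xt_indep : independent_families P
       (fun i => X i : T -> R * R) (fun h => t h : T -> R))
    (n m : nat) (HN : (2 <= n + m)%N) :
  {ae P, forall w,
     kansa_mx nu (fun i : 'I_n => X i w) (fun h : 'I_m => gamma (t h w))
       \in unitmx}.
Proof.
have g_reg := regular_curve gamma_curve.
have g_reg' : forall t, a <= t <= b -> regular_at gamma t.
  by move=> s sab; apply: g_reg.
have mg := measurable_curve_patch g_reg'.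
have mZ h : measurable_fun setT (curve_patch a b gamma \o t h).
  exact: measurableT_comp.
pose Z (k : bool * nat) : {RV P >-> (R * R)%type} :=
  if k.1 then X k.2 else mfun_Sub (mem_set (mZ k.2)).
have mOmega := open_measurable_prod Omega_open.
have tab h : \forall x \ae P, a <= t h x <= b.
  exists (t h @^-1` (~` `]a, b[)); split.
  - by apply: measurable_funPTI; exact: measurableC.
  - apply: (density_null (t_law h)) => //; first exact: measurableC.
    by rewrite setICl; exact: countable0.
  by move=> x; apply: contra_not; rewrite /= in_itv /= => /andP[/ltW -> /ltW ->].
have Z_indep := independent_merge (Z := fun k => Z k : T -> R * R) mg (fun=> erefl)
  (fun=> erefl) X_indep t_indep Xt_indep.
(* Almost surely [X i] lies in [Omega], which is open and so contains none of its boundary points,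
   while the curve runs in the boundary. *)
have Z_off i : \forall x \ae P, forall s, a <= s <= b -> gamma s != Z (true, i) x.
  exists (X i @^-1` (~` Omega)); split.
  - by apply: measurable_funPTI; exact: measurableC.
  - rewrite -[LHS]/(distribution P (X i) (~` Omega)) X_unif; last exact: measurableC.
    by rewrite setICl /leb2 measure0 mule0.
  move=> x; apply: contra_not => /= Xx s sab; apply/eqP => gs.
  have : boundary Omega (gamma s) by rewrite Omega_boundary; exists s; rewrite //= in_itv.
  by move=> [_]; apply; rewrite gs; move: Omega_open; rewrite openE; apply.
have Z_on h : \forall x \ae P, exists2 s, a <= s <= b & gamma s = Z (false, h) x.
  move: (tab h); apply: filterS => x tx; exists (t h x) => //.
  by rewrite /Z /= /curve_patch tx.
have Z_null i (B : set (R * R)) : measurable B -> leb2 B = 0%E -> P (Z (true, i) @^-1` B) = 0%E.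
  move=> mB B0; rewrite -[LHS]/(distribution P (X i) B) X_unif //.
  rewrite [leb2 (B `&` _)](_ : _ = 0%E) ?mule0 //.
  by apply: subset_measure0 B0 => //; exact: measurableI.
have Z_null_curve h (B : set (R * R)) : measurable B ->
    countable [set s | a <= s <= b /\ B (gamma s)] -> P (Z (false, h) @^-1` B) = 0%E.
  move=> mB cB.
  rewrite -[LHS]/(P (t h @^-1` (curve_patch a b gamma @^-1` B))).
  apply: (density_null (t_law h)) => //.
    by rewrite -[X in measurable X]setTI; exact: mg.
  (* Outside [[a, b]] the patched curve is constant, but only the part of the preimage inside []a,
     b[] carries mass. *)
  apply: sub_countable cB; apply: subset_card_le => s /= [+]; rewrite in_itv /=.
  by move=> + /andP[/ltW as_ /ltW sb]; rewrite /curve_patch as_ sb.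
have w_adm b' := @kansa_kernel_admissible R nu b' Hnu.
have main := almost_nonsingular_block w_adm g_reg' Z_indep Z_off Z_on Z_null Z_null_curve HN.
(* One null set serves all abscissas; off it the patched curve agrees with [gamma] at each of
   them. *)
have tabs : \forall x \ae P, forall h, a <= t h x <= b by apply/ae_foralln.
move: tabs main; apply: filterS2 => x tx; rewrite size_cat !size_map !size_iota.
rewrite unitmxE unitfE; congr (\det _ != 0).
rewrite (@kansa_kernel_mx _ _ _ _ _ _ (points Z ([seq (true, i) | i <- iota 0 n] ++
  [seq (false, i) | i <- iota 0 m]) x)) // => i; rewrite /points nth_cat size_map size_iota.
  by rewrite ltn_ord (nth_map 0%N) ?size_iota // nth_iota.
rewrite ltnNge leq_addr /= addKn (nth_map 0%N) ?size_iota // nth_iota //.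
by rewrite /Z /= /curve_patch tx.
Qed.
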